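(* Let $K\ge1$ and let $f=h+\overline{g}$ be a $K$-quasiregular harmonic mapping in the unit disk $\mathbb{D}$, with $h,g$ analytic in $\mathbb{D}$, such that $f(0)=0$, $\lambda_f(0)=1$ and $|\mathrm{Re}(h(z))|\leq M$ for all $z\in\mathbb{D}$, where $0\leq M<1$. Then $f$ is univalent in the disk $\mathbb{D}_{r_8}$ and $f(\mathbb{D}_{r_8})$ contains a schlicht disk $\mathbb{D}_{r_9}$, where $$r_8=\frac{K+1}{6\sqrt{3}\,K(1+M)}$$ and $$r_9=\frac{2\sqrt{3}\,K(1+M)}{K+1}\left(1+\left(\frac{36K^2(1+M)^2}{(K+1)^2}-1\right)\log\left(1-\frac{(K+1)^2}{36K^2(1+M)^2}\right)\right).$$
   Context: $\mathbb{D}_r(a)=\{z\in\mathbb{C}:|z-a|<r\}$, $\mathbb{D}_r=\mathbb{D}_r(0)$, $\mathbb{D}=\mathbb{D}_1$. A harmonic mapping in $\mathbb{D}$ is a complex-valued, twice continuously differentiable function $f$ with $4f_{z\bar z}=0$; it can be written $f=h+\overline{g}$ with $h,g$ analytic in $\mathbb{D}$. Put $\Lambda_f(z)=|f_z(z)|+|f_{\bar z}(z)|=|h'(z)|+|g'(z)|$, $\lambda_f(z)=\big||f_z(z)|-|f_{\bar z}(z)|\big|=\big||h'(z)|-|g'(z)|\big|$, and $J_f(z)=|h'(z)|^2-|g'(z)|^2$. The mapping $f$ is sense-preserving if $J_f>0$ in $\mathbb{D}$. A sense-preserving harmonic mapping $f$ is $K$-quasiregular ($K\ge1$) in $\mathbb{D}$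 if $\Lambda_f(z)\le K\lambda_f(z)$ for all $z\in\mathbb{D}$. Univalent means injective. A disk $\mathbb{D}_\rho(a)$ is a schlicht disk of $f$ if there is a subdomain $\Omega\subset\mathbb{D}$ such that $f$ is univalent in $\Omega$ and $f(\Omega)=\mathbb{D}_\rho(a)$; ''$f(\mathbb{D}_r)$ contains a schlicht disk $\mathbb{D}_\rho$'' means that $\Omega$ can be taken inside $\mathbb{D}_r$. *)

(* Defs.v *)
From Stdlib Require Import Reals.
From Coquelicot Require Import Coquelicot.
Open Scope R_scope.

Definition disk (a : C) (r : R) (z : C) : Prop := Cmod (z - a) < r.

Definition unit_disk : C -> Prop := disk (RtoC 0) 1.

(* Complex differentiability: the derivative is taken over the field C. *)
Definition analytic_on (A : C -> Prop) (h : C -> C) : Prop :=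
  forall z : C, A z -> @ex_derive C_AbsRing C_NormedModule h z.

(* Partial derivatives of f = u + i v in the real coordinates (x, y) of
   z = x + i y.  They are built from the total operator [Derive], so they are
   meaningful only where u and v are partially differentiable. *)
Definition partial_x (f : C -> C) (z : C) : C :=
  (Derive (fun x : R => Re (f (x, Im z))) (Re z),
   Derive (fun x : R => Im (f (x, Im z))) (Re z)).

Definition partial_y (f : C -> C) (z : C) : C :=
  (Derive (fun y : R => Re (f (Re z, y))) (Im z),
   Derive (fun y : R => Im (f (Re z, y))) (Im z)).

Definition d_z (f : C -> C) (z : C) : C :=
  ((partial_x f z - Ci * partial_y f z) / RtoC 2)%C.

Definition d_zbar (f : C -> C) (z : C) : C :=
  ((partial_x f z + Ci * partial_y f z) / RtoC 2)%C.

(* [ex_diff_n u 2 x y] asserts, at the point (x, y), that all partial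
   derivatives of u of order at most 2 exist and that they and u are
   continuous; over an open set A this is twice continuous differentiability. *)
Definition C2_on (A : C -> Prop) (f : C -> C) : Prop :=
  forall z : C, A z ->
    ex_diff_n (fun x y : R => Re (f (x, y))) 2 (Re z) (Im z) /\
    ex_diff_n (fun x y : R => Im (f (x, y))) 2 (Re z) (Im z).

Definition harmonic_mapping_on (A : C -> Prop) (f : C -> C) : Prop :=
  C2_on A f /\
  (forall z : C, A z -> (RtoC 4 * d_zbar (d_z f) z)%C = RtoC 0).

Definition Lambda (f : C -> C) (z : C) : R :=
  Cmod (d_z f z) + Cmod (d_zbar f z).

Definition lambda (f : C -> C) (z : C) : R :=
  Rabs (Cmod (d_z f z) - Cmod (d_zbar f z)).

Definition Jacobian (f : C -> C) (z : C) : R :=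
  Cmod (d_z f z) ^ 2 - Cmod (d_zbar f z) ^ 2.

Definition sense_preserving_on (A : C -> Prop) (f : C -> C) : Prop :=
  forall z : C, A z -> 0 < Jacobian f z.

Definition quasiregular_harmonic_on (A : C -> Prop) (K : R) (f : C -> C)
    : Prop :=
  harmonic_mapping_on A f /\
  sense_preserving_on A f /\
  (forall z : C, A z -> Lambda f z <= K * lambda f z).

Definition univalent_on (A : C -> Prop) (f : C -> C) : Prop :=
  forall z w : C, A z -> A w -> f z = f w -> z = w.

Definition connected_set (A : C -> Prop) : Prop :=
  forall U V : C -> Prop,
    @open C_UniformSpace U -> @open C_UniformSpace V ->
    (forall z : C, A z -> U z \/ V z) ->
    (exists z : C, A z /\ U z) -> (exists z : C, A z /\ V z) ->
    exists z : C, A z /\ U z /\ V z.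

Definition domain (A : C -> Prop) : Prop :=
  (exists z : C, A z) /\ @open C_UniformSpace A /\ connected_set A.

(* [disk a rho] is a schlicht disk of f contained in f(G). *)
Definition contains_schlicht_disk (G : C -> Prop) (f : C -> C)
    (a : C) (rho : R) : Prop :=
  exists Omega : C -> Prop,
    domain Omega /\
    (forall z : C, Omega z -> G z) /\
    univalent_on Omega f /\
    (forall w : C, disk a rho w <-> exists z : C, Omega z /\ f z = w).

Definition r8 (K M : R) : R := (K + 1) / (6 * sqrt 3 * K * (1 + M)).

Definition r9 (K M : R) : R :=
  2 * sqrt 3 * K * (1 + M) / (K + 1) *
  (1 + (36 * K ^ 2 * (1 + M) ^ 2 / (K + 1) ^ 2 - 1) *
       ln (1 - (K + 1) ^ 2 / (36 * K ^ 2 * (1 + M) ^ 2))).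

(* Main.v *)
Require Import Defs.
From Stdlib Require Import Reals Lra Lia Classical ClassicalEpsilon.
From Coquelicot Require Import Coquelicot.
Open Scope R_scope.

(** Put [rho = 1/sqrt 3] and [L = 6K(1+M)/(K+1)].  The Schwarz lemma, applied
    on the disc of radius [1 - |z|] about z to h followed by a conformal map of
    a half plane, gives [|h'| < 3(1+M)] for [|z| < rho], hence
    [|h'| + |g'| < L] there by quasiregularity.  For [|c| = 1] the function
    [phi = h' + c g'] is bounded by L and [|phi(0)| >= |h'(0)| - |g'(0)| = 1],
    so Schwarz-Pick bounds [Re (conj phi(0) phi(z)) / |phi(0)|] from below by
    [L (1 - L t) / (L - t)], [t = |z| / rho], which is positive when
    [|z| < rho / L = r8].  Given two points, some c satisfies
    [|A + c B| <= |A + conj B|] for the increments A, B of h, g; integrating the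
    bound along the segment yields univalence, and along a radius it yields
    [|f| >= r9] on [|z| = r8].  As f is open, the disc of radius r9 is covered.

    Analyticity only means complex differentiability here, but f is C^2, so
    h' = f_z and g' = conj f_zbar are differentiable again.  For twice
    differentiable functions the maximum principle is a second derivative test,
    and no integration theory is needed. *)

(** What stands in the way is the conjugate: an increment of f is not an increment of an analytic
    function. A unimodular c repairs this for one pair of points at a time and changes with the
    pair, so every estimate on phi has to be uniform in c; |h'| + |g'| < L and |h'(0)| - |g'(0)| = 1
    are exactly of this kind. The real part is taken along phi(0) because the mean value theorem
    survives only for real parts, and one fixed direction must serve the whole segment. The value
    1/sqrt 3 maximises t (1 - t^2), to which t / L is proportional when h' is bounded by a multiple
    of 1 / (1 - t^2); the bound proved here, (1 + M) / (1 - t), stays below 3(1 + M) because 1/sqrt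
    3 < 2/3. At |z| = r8 the factor 1 - L t vanishes, and r9 is the integral of the lower bound from
    0 to r8; the denominator L - t produces the logarithm. Covering the disc of radius r9 is a
    connectedness argument: the values taken in |z| < r8 and the values missed on |z| <= r8 form two
    open sets. *)

Lemma C_ext (z w : C) : Re z = Re w -> Im z = Im w -> z = w.
Proof. destruct z, w; simpl; congruence. Qed.

Ltac C_ring := apply C_ext; unfold Re, Im; simpl; ring.

Lemma im_le_Cmod (z : C) : Rabs (Im z) <= Cmod z.
Proof.
  replace (Cmod z) with (Cmod (- Ci * z)%C).
  - replace (Im z) with (Re (- Ci * z)%C) by (unfold Re, Im; simpl; ring).
    apply re_le_Cmod.
  - rewrite Cmod_mult, Cmod_opp, Cmod_Ci; ring.
Qed.

Lemma Cmod_le_Re_Im (z : C) : Cmod z <= Rabs (Re z) + Rabs (Im z).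
Proof.
  replace z with (RtoC (Re z) + Ci * RtoC (Im z))%C at 1
    by (C_ring).
  eapply Rle_trans; [apply Cmod_triangle|].
  rewrite Cmod_mult, Cmod_Ci, !Cmod_R; lra.
Qed.

Lemma Cmod_minus_sym (z w : C) : Cmod (z - w) = Cmod (w - z).
Proof. rewrite <- Cmod_opp; f_equal; ring. Qed.

Lemma Cmod_minus_triangle (x y z : C) :
  Cmod (x - z) <= Cmod (x - y) + Cmod (y - z).
Proof.
  replace (x - z)%C with ((x - y) + (y - z))%C by ring; apply Cmod_triangle.
Qed.

Lemma Cmod_le_diff (x y : C) : Cmod x - Cmod y <= Cmod (x - y).
Proof.
  pose proof (Cmod_triangle (x - y) y) as H.
  replace (x - y + y)%C with x in H by ring; lra.
Qed.

Lemma Cmod_le_sum (x y : C) : Cmod x - Cmod y <= Cmod (x + y).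
Proof.
  pose proof (Cmod_le_diff x (- y)) as H.
  rewrite Cmod_opp in H.
  now replace (x - - y)%C with (x + y)%C in H by ring.
Qed.

Lemma Cmod_minus_self (z : C) : Cmod (z - z) = 0.
Proof. replace (z - z)%C with (RtoC 0) by ring; apply Cmod_0. Qed.

(** * Complex continuity and differentiability *)

Definition ccont (f : C -> C) (z : C) : Prop :=
  forall e, 0 < e -> exists d, 0 < d /\
    forall w, Cmod (w - z) < d -> Cmod (f w - f z) < e.

(* Caratheodory's form of the derivative makes the calculus rules algebraic. *)
Definition cderiv (f : C -> C) (z l : C) : Prop :=
  exists q : C -> C, ccont q z /\ q z = l /\
    forall w, (f w = f z + q w * (w - z))%C.

Lemma ccont_const (c z : C) : ccont (fun _ => c) z.
Proof.
  intros e He; exists 1; split; [lra|]; intros w _.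
  now rewrite Cmod_minus_self.
Qed.

Lemma ccont_id (z : C) : ccont (fun w => w) z.
Proof. intros e He; exists e; auto. Qed.

Lemma ccont_plus f g z :
  ccont f z -> ccont g z -> ccont (fun w => f w + g w)%C z.
Proof.
  intros Hf Hg e He.
  destruct (Hf (e / 2)) as (d1 & Hd1 & H1); [lra|].
  destruct (Hg (e / 2)) as (d2 & Hd2 & H2); [lra|].
  exists (Rmin d1 d2); split; [now apply Rmin_glb_lt|]; intros w Hw.
  specialize (H1 w (Rlt_le_trans _ _ _ Hw (Rmin_l _ _))).
  specialize (H2 w (Rlt_le_trans _ _ _ Hw (Rmin_r _ _))).
  replace (f w + g w - (f z + g z))%C
    with ((f w - f z) + (g w - g z))%C by ring.
  pose proof (Cmod_triangle (f w - f z) (g w - g z)); lra.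
Qed.

Lemma ccont_bounded f z : ccont f z ->
  exists B d, 0 < B /\ 0 < d /\ forall w, Cmod (w - z) < d -> Cmod (f w) <= B.
Proof.
  intros Hf; destruct (Hf 1) as (d & Hd & H); [lra|].
  exists (Cmod (f z) + 1), d.
  pose proof (Cmod_ge_0 (f z)).
  repeat split; [lra|lra|]; intros w Hw; specialize (H w Hw).
  pose proof (Cmod_le_diff (f w) (f z)); lra.
Qed.

Lemma ccont_mult f g z :
  ccont f z -> ccont g z -> ccont (fun w => f w * g w)%C z.
Proof.
  intros Hf Hg e He.
  destruct (ccont_bounded g z Hg) as (B & d0 & HB & Hd0 & H0).
  pose proof (Cmod_ge_0 (f z)) as Hfz.
  destruct (Hf (e / (2 * B))) as (d1 & Hd1 & H1).
  { apply Rdiv_lt_0_compat; lra. }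
  destruct (Hg (e / (2 * (Cmod (f z) + 1)))) as (d2 & Hd2 & H2).
  { apply Rdiv_lt_0_compat; lra. }
  exists (Rmin d0 (Rmin d1 d2)); split; [repeat apply Rmin_glb_lt; lra|].
  intros w Hw.
  assert (Hw0 : Cmod (w - z) < d0)
    by (eapply Rlt_le_trans; [apply Hw|apply Rmin_l]).
  assert (Hw12 : Cmod (w - z) < Rmin d1 d2)
    by (eapply Rlt_le_trans; [apply Hw|apply Rmin_r]).
  specialize (H0 w Hw0).
  specialize (H1 w (Rlt_le_trans _ _ _ Hw12 (Rmin_l _ _))).
  specialize (H2 w (Rlt_le_trans _ _ _ Hw12 (Rmin_r _ _))).
  replace (f w * g w - f z * g z)%C
    with ((f w - f z) * g w + f z * (g w - g z))%C by ring.
  eapply Rle_lt_trans; [apply Cmod_triangle|].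
  rewrite !Cmod_mult.
  pose proof (Cmod_ge_0 (f w - f z)).
  pose proof (Cmod_ge_0 (g w - g z)).
  apply Rle_lt_trans with
    (Cmod (f w - f z) * B + (Cmod (f z) + 1) * Cmod (g w - g z)).
  { apply Rplus_le_compat; [apply Rmult_le_compat_l; lra|].
    apply Rmult_le_compat_r; lra. }
  replace e with (e / (2 * B) * B
    + (Cmod (f z) + 1) * (e / (2 * (Cmod (f z) + 1)))) by (field; lra).
  apply Rplus_lt_compat; [apply Rmult_lt_compat_r; lra|].
  apply Rmult_lt_compat_l; lra.
Qed.

Lemma ccont_neq_0 f z : ccont f z -> f z <> 0 ->
  exists d, 0 < d /\ forall w, Cmod (w - z) < d -> Cmod (f z) / 2 <= Cmod (f w).
Proof.
  intros Hf Hz.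
  apply Cmod_gt_0 in Hz.
  destruct (Hf (Cmod (f z) / 2)) as (d & Hd & H); [lra|].
  exists d; split; [lra|]; intros w Hw; specialize (H w Hw).
  rewrite Cmod_minus_sym in H.
  pose proof (Cmod_le_diff (f z) (f w)); lra.
Qed.

Lemma Cinv_minus (a b : C) :
  a <> 0 -> b <> 0 -> (/ a - / b = - ((a - b) * (/ a * / b)))%C.
Proof. intros; field; auto. Qed.

Lemma ccont_inv f z : ccont f z -> f z <> 0 -> ccont (fun w => / f w)%C z.
Proof.
  intros Hf Hz e He.
  destruct (ccont_neq_0 f z Hf Hz) as (d0 & Hd0 & H0).
  assert (Hm : 0 < Cmod (f z)) by now apply Cmod_gt_0.
  set (m := Cmod (f z)) in *.
  destruct (Hf (e * (m * m / 2))) as (d1 & Hd1 & H1).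
  { apply Rmult_lt_0_compat; nra. }
  exists (Rmin d0 d1); split; [now apply Rmin_glb_lt|]; intros w Hw.
  specialize (H0 w (Rlt_le_trans _ _ _ Hw (Rmin_l _ _))).
  specialize (H1 w (Rlt_le_trans _ _ _ Hw (Rmin_r _ _))).
  assert (Hfw : f w <> 0) by (apply Cmod_gt_0; lra).
  rewrite Cinv_minus, Cmod_opp, !Cmod_mult, !Cmod_inv by auto.
  fold m.
  assert (Hi : / Cmod (f w) * / m <= / (m / 2) * / m).
  { apply Rmult_le_compat_r; [left; now apply Rinv_0_lt_compat|].
    apply Rinv_le_contravar; lra. }
  replace e with (e * (m * m / 2) * (/ (m / 2) * / m)) by (field; lra).
  assert (0 < / (m / 2) * / m)
    by (apply Rmult_lt_0_compat; apply Rinv_0_lt_compat; lra).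
  apply Rle_lt_trans with (Cmod (f w - f z) * (/ (m / 2) * / m)).
  - apply Rmult_le_compat_l; [apply Cmod_ge_0|lra].
  - apply Rmult_lt_compat_r; lra.
Qed.

Lemma ccont_local f g z d : 0 < d ->
  (forall w, Cmod (w - z) < d -> f w = g w) -> ccont f z -> ccont g z.
Proof.
  intros Hd E Hf e He; destruct (Hf e He) as (d' & Hd' & H).
  exists (Rmin d d'); split; [now apply Rmin_glb_lt|]; intros w Hw.
  rewrite <- !E.
  - apply H; eapply Rlt_le_trans; [apply Hw|apply Rmin_r].
  - now rewrite Cmod_minus_self.
  - eapply Rlt_le_trans; [apply Hw|apply Rmin_l].
Qed.

Lemma ccont_ext f g z : (forall w, f w = g w) -> ccont f z -> ccont g z.
Proof. intros E; apply ccont_local with 1; auto; lra. Qed.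

Lemma cderiv_ccont f z l : cderiv f z l -> ccont f z.
Proof.
  intros (q & Hq & _ & E).
  apply ccont_ext with (fun w => f z + q w * (w + - z))%C.
  { intros w; rewrite (E w); ring. }
  apply ccont_plus; [apply ccont_const|].
  apply ccont_mult; [exact Hq|].
  apply ccont_plus; [apply ccont_id|apply ccont_const].
Qed.

Lemma cderiv_const (c z : C) : cderiv (fun _ => c) z 0.
Proof.
  exists (fun _ => RtoC 0); split; [apply ccont_const|split; [easy|]].
  intros w; ring.
Qed.

Lemma cderiv_id (z : C) : cderiv (fun w => w) z 1.
Proof.
  exists (fun _ => RtoC 1); split; [apply ccont_const|split; [easy|]].
  intros w; ring.
Qed.

Lemma cderiv_plus f g z a b : cderiv f z a -> cderiv g z b ->
  cderiv (fun w => f w + g w)%C z (a + b)%C.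
Proof.
  intros (p & Hp & Ep & Ef) (q & Hq & Eq & Eg).
  exists (fun w => p w + q w)%C; split; [now apply ccont_plus|split].
  - congruence.
  - intros w; rewrite (Ef w), (Eg w); ring.
Qed.

Lemma cderiv_mult f g z a b : cderiv f z a -> cderiv g z b ->
  cderiv (fun w => f w * g w)%C z (a * g z + f z * b)%C.
Proof.
  intros Hf Hg.
  pose proof (cderiv_ccont _ _ _ Hg) as Hgc.
  destruct Hf as (p & Hp & Ep & Ef), Hg as (q & Hq & Eq & Eg).
  exists (fun w => p w * g w + f z * q w)%C; split; [|split].
  - apply ccont_plus; apply ccont_mult; auto; apply ccont_const.
  - congruence.
  - intros w; rewrite (Ef w), (Eg w); ring.
Qed.

Lemma cderiv_eq f z a b : a = b -> cderiv f z a -> cderiv f z b.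
Proof. now intros ->. Qed.

Lemma cderiv_scal (c : C) f z a : cderiv f z a ->
  cderiv (fun w => c * f w)%C z (c * a)%C.
Proof.
  intros H.
  refine (cderiv_eq _ _ _ _ _ (cderiv_mult _ _ _ _ _ (cderiv_const c z) H)).
  ring.
Qed.

Lemma cderiv_minus f g z a b : cderiv f z a -> cderiv g z b ->
  cderiv (fun w => f w - g w)%C z (a - b)%C.
Proof.
  intros (p & Hp & Ep & Ef) (q & Hq & Eq & Eg).
  exists (fun w => p w + (RtoC (-1)) * q w)%C; split; [|split].
  - apply ccont_plus; auto; apply ccont_mult; auto; apply ccont_const.
  - rewrite Ep, Eq; C_ring.
  - intros w; rewrite (Ef w), (Eg w); C_ring.
Qed.

Lemma cderiv_comp_translate f z (c a : C) : cderiv f (z + c)%C a ->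
  cderiv (fun w => f (w + c)%C) z a.
Proof.
  intros (p & Hp & Ep & Ef).
  exists (fun w => p (w + c)%C); split; [|split; [exact Ep|]].
  - intros e He; destruct (Hp e He) as (d & Hd & H).
    exists d; split; auto; intros w Hw; apply H.
    now replace (w + c - (z + c))%C with (w - z)%C by ring.
  - intros w; rewrite (Ef (w + c)%C); ring.
Qed.

(** The factorisation in [cderiv] is asked at every w, but away from z it merely defines q as the
    difference quotient. The epsilon form makes locality visible and is the one that estimates
    use. *)
Lemma cderivP f z l : cderiv f z l <->
  forall e, 0 < e -> exists d, 0 < d /\ forall w, Cmod (w - z) < d ->
    Cmod (f w - f z - l * (w - z)) <= e * Cmod (w - z).
Proof.
  split.
  - intros (q & Hq & El & E) e He; destruct (Hq e He) as (d & Hd & H).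
    exists d; split; auto; intros w Hw; specialize (H w Hw).
    rewrite (E w), <- El.
    replace (f z + q w * (w - z) - f z - q z * (w - z))%C
      with ((q w - q z) * (w - z))%C by ring.
    rewrite Cmod_mult; apply Rmult_le_compat_r; [apply Cmod_ge_0|lra].
  - intros H.
    exists (fun w => if excluded_middle_informative (w = z) then l
             else (f w - f z) / (w - z))%C; split; [|split].
    + intros e He; destruct (H (e / 2)) as (d & Hd & Hw); [lra|].
      exists d; split; auto; intros w Hwd; specialize (Hw w Hwd).
      destruct (excluded_middle_informative (z = z)) as [_|n];
        [|now contradict n].
      destruct (excluded_middle_informative (w = z)) as [_|n].
      * now rewrite Cmod_minus_self.
      * assert (Hn : (w - z <> 0)%C).
        { intros E; apply n; replace w with (w - z + z)%C by ring.
          rewrite E; ring. }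
        replace ((f w - f z) / (w - z) - l)%C
          with ((f w - f z - l * (w - z)) / (w - z))%C by (field; auto).
        rewrite Cmod_div by auto.
        apply Cmod_gt_0 in Hn.
        apply Rle_lt_trans with (e / 2); [|lra].
        apply Rle_div_l; lra.
    + destruct (excluded_middle_informative (z = z)); congruence.
    + intros w; destruct (excluded_middle_informative (w = z)) as [->|n].
      * ring.
      * field; intros E; apply n.
        replace w with (w - z + z)%C by ring; rewrite E; ring.
Qed.

Lemma cderiv_local f g z l d : 0 < d ->
  (forall w, Cmod (w - z) < d -> f w = g w) -> cderiv f z l -> cderiv g z l.
Proof.
  intros Hd E; rewrite !cderivP; intros H e He.
  destruct (H e He) as (d' & Hd' & Hw).
  exists (Rmin d d'); split; [now apply Rmin_glb_lt|]; intros w Hwd.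
  rewrite <- !E.
  - apply Hw; eapply Rlt_le_trans; [apply Hwd|apply Rmin_r].
  - now rewrite Cmod_minus_self.
  - eapply Rlt_le_trans; [apply Hwd|apply Rmin_l].
Qed.

Lemma cderiv_inv f z a : cderiv f z a -> f z <> 0 ->
  cderiv (fun w => / f w)%C z (- a * (/ f z * / f z))%C.
Proof.
  intros Hf Hz.
  pose proof (cderiv_ccont _ _ _ Hf) as Hc.
  destruct (ccont_neq_0 f z Hc Hz) as (d & Hd & H0).
  destruct Hf as (p & Hp & Ep & Ef).
  pose proof (proj1 (Cmod_gt_0 _) Hz) as Hm.
  (* Where f vanishes, [/ f w] is a default value and the factorisation may fail; it is therefore
     proved for a function that agrees with [/ f] only near z. *)
  apply cderiv_local with
    (fun w => / f z + - (p w * (/ f w * / f z)) * (w - z))%C d; auto.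
  - intros w Hw; specialize (H0 w Hw).
    assert (f w <> 0) by (apply Cmod_gt_0; lra).
    replace (- (p w * (/ f w * / f z)) * (w - z))%C
      with (- ((f w - f z) * (/ f w * / f z)))%C by (rewrite (Ef w) at 1; ring).
    rewrite <- Cinv_minus by auto; ring.
  - exists (fun w => (RtoC (-1)) * (p w * (/ f w * / f z)))%C; split; [|split].
    + apply ccont_mult; [apply ccont_const|].
      apply ccont_mult; [exact Hp|].
      apply ccont_mult; [now apply ccont_inv|apply ccont_const].
    + rewrite Ep; C_ring.
    + intros w; C_ring.
Qed.

(** The passage from complex to real calculus: through it the real mean value theorem and the second
    derivative test apply on lines. The weight w selects which real component of f is seen. *)
Lemma is_derive_slice f (a v w l : C) (x : R) :
  cderiv f (a + RtoC x * v)%C l ->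
  is_derive (fun t : R => Re (w * f (a + RtoC t * v))%C) x (Re (w * l * v)%C).
Proof.
  intros Hf.
  apply is_derive_Reals; intros e He.
  rewrite cderivP in Hf.
  pose proof (Cmod_ge_0 w); pose proof (Cmod_ge_0 v).
  assert (HP : 0 <= Cmod w * Cmod v) by now apply Rmult_le_pos.
  destruct (Hf (e / (Cmod w * Cmod v + 1))) as (d & Hd & H').
  { apply Rdiv_lt_0_compat; lra. }
  assert (Hdv : 0 < d / (Cmod v + 1)) by (apply Rdiv_lt_0_compat; lra).
  exists (mkposreal _ Hdv); intros t Ht0 Ht; simpl in Ht.
  assert (Hv : Cmod (a + RtoC (x + t) * v - (a + RtoC x * v))
               = Rabs t * Cmod v).
  { rewrite <- Cmod_R, <- Cmod_mult; f_equal; C_ring. }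
  assert (Ht' : 0 < Rabs t) by now apply Rabs_pos_lt.
  assert (Hlt : Rabs t * (Cmod v + 1) < d) by (apply Rlt_div_r in Ht; lra).
  specialize (H' (a + RtoC (x + t) * v)%C).
  rewrite Hv in H'.
  assert (HB : Rabs t * Cmod v < d) by nra.
  specialize (H' HB).
  set (D := (f (a + RtoC (x + t) * v) - f (a + RtoC x * v)
             - l * (a + RtoC (x + t) * v - (a + RtoC x * v)))%C) in *.
  replace ((Re (w * f (a + RtoC (x + t) * v))%C
            - Re (w * f (a + RtoC x * v))%C) / t - Re (w * l * v)%C)
    with (Re (w * D)%C / t)
    by (unfold D; unfold Re, Im; simpl; field; auto).
  unfold Rdiv; rewrite Rabs_mult, Rabs_inv.
  apply Rlt_div_l; [lra|].
  eapply Rle_lt_trans; [apply re_le_Cmod|].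
  rewrite Cmod_mult.
  apply Rle_lt_trans with (Cmod w * (e / (Cmod w * Cmod v + 1)
    * (Rabs t * Cmod v))).
  { now apply Rmult_le_compat_l. }
  replace (Cmod w * (e / (Cmod w * Cmod v + 1) * (Rabs t * Cmod v)))
    with (e * Rabs t * (Cmod w * Cmod v / (Cmod w * Cmod v + 1)))
    by (field; lra).
  rewrite <- (Rmult_1_r (e * Rabs t)) at 2.
  apply Rmult_lt_compat_l; [nra|].
  apply Rlt_div_l; lra.
Qed.

Lemma ex_derive_cderiv (f : C -> C) (z : C) :
  @ex_derive C_AbsRing C_NormedModule f z -> exists l, cderiv f z l.
Proof.
  intros [l [_ H]]; exists l; apply cderivP; intros e He.
  specialize (H z (fun P HP => HP) (mkposreal e He)).
  destruct H as [d H]; exists d; split; [apply cond_pos|]; intros w Hw.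
  specialize (H w Hw).
  rewrite (Cmult_comm l).
  exact H.
Qed.

(** The mean value theorem fails for complex values but holds for each real component. The free
    weight w is what adapts it: to the conjugate of the increment for a norm bound, to a direction
    of positivity for injectivity. *)
Lemma C_segment_mean_value f f' (a b w : C) :
  (forall t, 0 <= t <= 1 ->
     cderiv f (a + RtoC t * (b - a))%C (f' (a + RtoC t * (b - a))%C)) ->
  exists t, 0 <= t <= 1 /\
    Re (w * (f b - f a))%C = Re (w * f' (a + RtoC t * (b - a)) * (b - a))%C.
Proof.
  intros H.
  destruct (MVT_cor2 (fun t => Re (w * f (a + RtoC t * (b - a))))%C
    (fun t => Re (w * f' (a + RtoC t * (b - a)) * (b - a))%C) 0 1)
    as (t & E & Ht); [lra| |].
  - intros t Ht; apply is_derive_Reals, is_derive_slice, H; lra.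
  - exists t; split; [lra|].
    replace (a + RtoC 1 * (b - a))%C with b in E by ring.
    replace (a + RtoC 0 * (b - a))%C with a in E by ring.
    rewrite Rminus_0_r, Rmult_1_r in E; rewrite <- E.
    unfold Re, Im; simpl; ring.
Qed.

(** * Compactness of closed discs *)

(** Compactness in gauge form: d plays the part of the smallest radius of a finite subcover. *)
Lemma closed_disk_cover (c : C) (r : R) (delta : C -> R) :
  (forall z, Cmod (z - c) <= r -> 0 < delta z) ->
  exists d, 0 < d /\ forall z, Cmod (z - c) <= r ->
    exists u, Cmod (u - c) <= r /\ Cmod (z - u) < delta u /\ d <= delta u.
Proof.
  intros Hpos.
  (* Points outside the disc get a radius so small that it misses the disc. *)
  set (D := fun u : C => if Rle_dec (Cmod (u - c)) r then delta u / 2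
                         else (Cmod (u - c) - r) / 2).
  assert (HD : forall u, 0 < D u).
  { intros u; unfold D; destruct (Rle_dec (Cmod (u - c)) r) as [H|H].
    - specialize (Hpos u H); lra.
    - lra. }
  destruct (compactness_value_2d (Re c - r) (Re c + r) (Im c - r) (Im c + r)
    (fun x y => mkposreal (D (x, y)) (HD (x, y)))) as [d Hd].
  exists d; split; [apply cond_pos|]; intros z Hz.
  assert (Hbox : forall x y, Rabs (x - y) <= r -> y - r <= x <= y + r).
  { intros x y; intros H; apply Rabs_le_between in H; lra. }
  specialize (Hd (Re z) (Im z)).
  assert (Hx : Rabs (Re z - Re c) <= r)
    by (eapply Rle_trans; [apply (re_le_Cmod (z - c))|exact Hz]).
  assert (Hy : Rabs (Im z - Im c) <= r)
    by (eapply Rle_trans; [apply (im_le_Cmod (z - c))|exact Hz]).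
  specialize (Hd (Hbox _ _ Hx) (Hbox _ _ Hy)).
  apply NNPP in Hd; destruct Hd as (u1 & u2 & _ & _ & H1 & H2 & H3).
  simpl in H1, H2, H3; exists (u1, u2).
  (* The compactness lemma works with squares; a square of half-side D lies in the round disc of
     radius 2 D, hence the halved radii. *)
  assert (Hzu : Cmod (z - (u1, u2)) < 2 * D (u1, u2)).
  { eapply Rle_lt_trans; [apply Cmod_le_Re_Im|].
    change (Rabs (Re z - u1) + Rabs (Im z - u2) < 2 * D (u1, u2)); lra. }
  pose proof (cond_pos d).
  unfold D in Hzu, H3; destruct (Rle_dec (Cmod ((u1, u2) - c)) r) as [H'|H'].
  - split; [auto|]; lra.
  - exfalso; pose proof (Cmod_minus_triangle (u1, u2) z c).
    rewrite (Cmod_minus_sym (u1, u2) z) in *; lra.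
Qed.

(** The one extremal principle of the development: applied to minus a continuous function it gives
    the maximum in the maximum principle, applied to |f - w| it serves the open mapping theorem and
    the closedness of images. *)
Lemma lsc_attains_min (F : C -> R) (c : C) (r : R) : 0 <= r ->
  (forall z, Cmod (z - c) <= r -> forall e, 0 < e -> exists d, 0 < d /\
     forall w, Cmod (w - c) <= r -> Cmod (w - z) < d -> F z - e < F w) ->
  exists z0, Cmod (z0 - c) <= r /\
    forall w, Cmod (w - c) <= r -> F z0 <= F w.
Proof.
  intros Hr Hlsc.
  assert (Hc : Cmod (c - c) <= r) by now rewrite Cmod_minus_self.
  (* A single covering argument, used once to bound F below and once to show
     that the infimum is attained. *)
  assert (Hunif : forall eta : C -> R,
    (forall z, Cmod (z - c) <= r -> 0 < eta z) ->
    exists d, 0 < d /\ forall z, Cmod (z - c) <= r ->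
      exists u, Cmod (u - c) <= r /\ F u - eta u < F z /\ d <= eta u).
  { intros eta Heta.
    assert (Hch : forall z, exists d, Cmod (z - c) <= r -> 0 < d /\
      forall w, Cmod (w - c) <= r -> Cmod (w - z) < d -> F z - eta z < F w).
    { intros z; destruct (Rle_dec (Cmod (z - c)) r) as [H|H].
      - destruct (Hlsc z H (eta z) (Heta z H)) as (d & Hd); now exists d.
      - exists 0; tauto. }
    apply choice in Hch; destruct Hch as [dl Hdl].
    destruct (closed_disk_cover c r (fun z => Rmin (dl z) (eta z)))
      as (d & Hd & Hcov).
    { intros z Hz; apply Rmin_glb_lt; [now apply Hdl|auto]. }
    exists d; split; auto; intros z Hz.
    destruct (Hcov z Hz) as (u & Hu & Hzu & Hdu); exists u; split; auto.
    split.
    - apply Hdl; auto; eapply Rlt_le_trans; [apply Hzu|apply Rmin_l].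
    - eapply Rle_trans; [apply Hdu|apply Rmin_r]. }
  (* From d <= 1 / (1 + |F u|) follows |F u| <= 1/d, so F > - 1/d - 1 everywhere. *)
  destruct (Hunif (fun z => / (1 + Rabs (F z)))) as (d & Hd & Hb).
  { intros z _; apply Rinv_0_lt_compat; pose proof (Rabs_pos (F z)); lra. }
  destruct (completeness (fun y => exists z, Cmod (z - c) <= r /\ y = - F z))
    as [m [Hub Hlub]].
  { exists (/ d + 1); intros y (z & Hz & ->).
    destruct (Hb z Hz) as (u & Hu & H1 & H2).
    pose proof (Rabs_pos (F u)) as Hp.
    assert (Hi : 1 + Rabs (F u) <= / d).
    { rewrite <- (Rinv_inv (1 + Rabs (F u))).
      apply Rinv_le_contravar; auto. }
    assert (/ (1 + Rabs (F u)) <= 1).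
    { apply Rle_trans with (/ 1); [apply Rinv_le_contravar; lra|].
      rewrite Rinv_1; lra. }
    pose proof (Rle_abs (- F u)) as Ha; rewrite Rabs_Ropp in Ha; lra. }
  { exists (- F c), c; auto. }
  apply NNPP; intros Hno.
  assert (Hgt : forall z, Cmod (z - c) <= r -> - m < F z).
  { intros z Hz.
    assert (Hle : - F z <= m) by (apply Hub; now exists z).
    destruct (Rle_lt_or_eq_dec _ _ Hle) as [H|H]; [lra|].
    exfalso; apply Hno; exists z; split; auto; intros w Hw.
    assert (- F w <= m) by (apply Hub; now exists w); lra. }
  (* Here - m is the infimum. If it is not attained, half the gap F + m is an admissible tolerance;
     then F z + m > (F u + m) / 2 >= d', which raises the infimum by d'. *)
  destruct (Hunif (fun z => (F z + m) / 2)) as (d' & Hd' & Hb').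
  { intros z Hz; specialize (Hgt z Hz); lra. }
  assert (m <= m - d'); [|lra].
  apply Hlub; intros y (z & Hz & ->).
  destruct (Hb' z Hz) as (u & Hu & H1 & H2); lra.
Qed.

(** * The maximum principle *)

(** If l > 0, then near 0 the sign of u'(y) - u'(0) is that of y. Hence u exceeds u(0) on the right
    when u'(0) >= 0 and on the left otherwise. Differentiability of u' at the single point 0
    suffices. *)
Lemma second_derivative_test (u u' : R -> R) (l d : R) : 0 < d ->
  (forall x, Rabs x < d -> is_derive u x (u' x)) -> is_derive u' 0 l ->
  (forall x, Rabs x < d -> u x <= u 0) -> l <= 0.
Proof.
  intros Hd Hu Hu' Hmax.
  destruct (Rle_lt_dec l 0) as [H|Hl]; auto; exfalso.
  apply is_derive_Reals in Hu'.
  destruct (Hu' (l / 2)) as [dl Hdl]; [lra|].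
  set (x := Rmin d dl / 2).
  assert (Hx : 0 < x < d /\ x < dl).
  { pose proof (cond_pos dl); unfold x.
    pose proof (Rmin_l d dl); pose proof (Rmin_r d dl).
    assert (0 < Rmin d dl) by (apply Rmin_glb_lt; lra); lra. }
  assert (Hq : forall y, y <> 0 -> Rabs y <= x -> 0 < (u' y - u' 0) / y).
  { intros y Hy Hyx; specialize (Hdl y Hy).
    assert (Hyd : Rabs y < dl) by lra; specialize (Hdl Hyd).
    rewrite Rplus_0_l in Hdl; apply Rabs_def2 in Hdl; lra. }
  assert (Habs : forall y, - x <= y <= x -> Rabs y <= x)
    by (intros y Hy; apply Rabs_le; lra).
  destruct (Rle_lt_dec 0 (u' 0)) as [H0|H0].
  - destruct (MVT_cor2 u u' 0 x) as (y & E & Hy); [lra| |].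
    { intros y Hy; apply is_derive_Reals, Hu.
      specialize (Habs y); lra. }
    specialize (Hq y); specialize (Habs y).
    assert (Hp : 0 < (u' y - u' 0) / y) by (apply Hq; lra).
    assert (0 < u' y - u' 0).
    { replace (u' y - u' 0) with ((u' y - u' 0) / y * y) by (field; lra).
      apply Rmult_lt_0_compat; lra. }
    assert (Hx' : Rabs x < d) by (rewrite Rabs_pos_eq; lra).
    specialize (Hmax x Hx'); nra.
  - destruct (MVT_cor2 u u' (- x) 0) as (y & E & Hy); [lra| |].
    { intros y Hy; apply is_derive_Reals, Hu.
      specialize (Habs y); lra. }
    specialize (Hq y); specialize (Habs y).
    assert (Hp : 0 < (u' y - u' 0) / y) by (apply Hq; lra).
    assert (0 < u' 0 - u' y).
    { replace (u' 0 - u' y) with ((u' y - u' 0) / y * (- y)) by (field; lra).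
      apply Rmult_lt_0_compat; lra. }
    assert (Hx' : Rabs (- x) < d) by (rewrite Rabs_left; lra).
    specialize (Hmax (- x) Hx'); nra.
Qed.

Lemma is_derive_slice_Re f (a v l : C) (x : R) :
  cderiv f (a + RtoC x * v)%C l ->
  is_derive (fun t : R => Re (f (a + RtoC t * v)%C)) x (Re (l * v)%C).
Proof.
  intros H; apply (is_derive_slice f a v 1) in H.
  rewrite Cmult_1_l in H.
  revert H; apply is_derive_ext; intros t; now rewrite Cmult_1_l.
Qed.

Lemma is_derive_slice_Im f (a v l : C) (x : R) :
  cderiv f (a + RtoC x * v)%C l ->
  is_derive (fun t : R => Im (f (a + RtoC t * v)%C)) x (Im (l * v)%C).
Proof.
  intros H; apply (is_derive_slice f a v (- Ci)) in H.
  replace (Im (l * v)%C) with (Re (- Ci * l * v)%C)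
    by (unfold Re, Im; simpl; ring).
  revert H; apply is_derive_ext; intros t; unfold Re, Im; simpl; ring.
Qed.

(** [Re (Cconj p * q)] is the inner product of the plane: f = g gives the derivative of |f|^2 along
    a line, and g = f' v then gives the second one. *)
Lemma is_derive_inner f g (a v l m : C) (x : R) :
  cderiv f (a + RtoC x * v)%C l -> cderiv g (a + RtoC x * v)%C m ->
  is_derive (fun t : R => Re (Cconj (f (a + RtoC t * v)) * g (a + RtoC t * v))%C)
    x (Re (Cconj (l * v) * g (a + RtoC x * v)
           + Cconj (f (a + RtoC x * v)) * (m * v))%C).
Proof.
  intros Hf Hg.
  pose proof (is_derive_slice_Re _ _ _ _ _ Hf) as Hf1.
  pose proof (is_derive_slice_Im _ _ _ _ _ Hf) as Hf2.
  pose proof (is_derive_slice_Re _ _ _ _ _ Hg) as Hg1.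
  pose proof (is_derive_slice_Im _ _ _ _ _ Hg) as Hg2.
  apply is_derive_ext with (fun t : R =>
    plus (mult (Re (f (a + RtoC t * v)%C)) (Re (g (a + RtoC t * v)%C)))
         (mult (Im (f (a + RtoC t * v)%C)) (Im (g (a + RtoC t * v)%C)))).
  { intros t; unfold plus, mult; simpl; unfold Re, Im, Cconj; simpl; ring. }
  evar_last.
  - apply @is_derive_plus;
      apply @is_derive_mult; [exact Hf1|exact Hg1| |exact Hf2|exact Hg2|];
      intros; apply Rmult_comm.
  - unfold plus, mult; simpl; unfold Re, Im, Cconj; simpl; ring.
Qed.

(* The Laplacian of [|chi|^2 + dl |z - c|^2] is [4 |chi'|^2 + 4 dl]. *)
Lemma no_interior_max (chi chi' : C -> C) (chi2 z0 c : C) (dl s : R) :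
  0 < dl -> 0 < s ->
  (forall z, Cmod (z - z0) < s -> cderiv chi z (chi' z)) ->
  cderiv chi' z0 chi2 ->
  ~ (forall z, Cmod (z - z0) < s ->
       Cmod (chi z) ^ 2 + dl * Cmod (z - c) ^ 2
       <= Cmod (chi z0) ^ 2 + dl * Cmod (z0 - c) ^ 2).
Proof.
  intros Hdl Hs H1 H2 Hmax.
  assert (Hdir : forall v, Cmod v = 1 ->
    Re (Cconj (chi' z0 * v) * (chi' z0 * v)
        + Cconj (chi z0) * (chi2 * v * v))%C + dl <= 0).
  { intros v Hv.
    assert (E0 : (z0 + RtoC 0 * v = z0)%C) by ring.
    assert (Hin : forall x, Rabs x < s -> Cmod (z0 + RtoC x * v - z0) < s).
    { intros x Hx; replace (z0 + RtoC x * v - z0)%C with (RtoC x * v)%C by ring.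
      rewrite Cmod_mult, Cmod_R, Hv; lra. }
    assert (Hcc : forall z, cderiv (fun w => w - c)%C z 1).
    { intros z; refine (cderiv_eq _ _ _ _ _
        (cderiv_minus _ _ _ _ _ (cderiv_id z) (cderiv_const c z))); ring. }
    assert (Hsq : forall z : C, Cmod z ^ 2 = Re (Cconj z * z)%C).
    { intros z; rewrite Cmod2_alt; unfold Re, Im, Cconj; simpl; ring. }
    apply Rmult_le_reg_l with 2; [lra|]; rewrite Rmult_0_r.
    apply (second_derivative_test
      (fun x => Cmod (chi (z0 + RtoC x * v)%C) ^ 2
                + dl * Cmod (z0 + RtoC x * v - c) ^ 2)
      (fun x => 2 * Re (Cconj (chi (z0 + RtoC x * v))
                        * (chi' (z0 + RtoC x * v) * v))%C
                + dl * (2 * Re (Cconj (z0 + RtoC x * v - c) * (1 * v))%C))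
      _ s Hs).
    - intros x Hx.
      pose proof (H1 _ (Hin x Hx)) as Hd.
      pose proof (is_derive_inner _ _ _ _ _ _ _ Hd Hd) as D1.
      pose proof (is_derive_inner _ _ z0 v _ _ x (Hcc _) (Hcc _)) as D2.
      apply is_derive_ext with (fun x : R =>
        plus (Re (Cconj (chi (z0 + RtoC x * v)) * chi (z0 + RtoC x * v))%C)
         (scal dl (Re (Cconj (z0 + RtoC x * v - c) * (z0 + RtoC x * v - c))%C))).
      { intros t; rewrite !Hsq; reflexivity. }
      evar_last.
      + apply @is_derive_plus; [exact D1|apply @is_derive_scal; exact D2].
      + unfold plus, scal, mult; simpl; unfold mult, Re, Im, Cconj; simpl; ring.
    - rewrite <- E0 in H2.
      assert (Hd : cderiv chi (z0 + RtoC 0 * v)%C (chi' (z0 + RtoC 0 * v)%C)).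
      { apply H1, Hin; rewrite Rabs_R0; lra. }
      pose proof (is_derive_inner _ _ _ _ _ _ _ Hd
        (cderiv_mult _ _ _ _ _ H2 (cderiv_const v _))) as D1.
      pose proof (is_derive_inner _ _ z0 v _ _ 0 (Hcc _)
        (cderiv_const (1 * v)%C _)) as D2.
      evar_last.
      + apply @is_derive_plus; apply @is_derive_scal;
          [exact D1|apply @is_derive_scal; exact D2].
      + rewrite E0.
        assert (Hv2 : fst v * fst v = 1 - snd v * snd v).
        { pose proof (Cmod2_alt v) as E; rewrite Hv in E.
          unfold Re, Im in E; simpl in E; lra. }
        unfold plus, scal, mult; simpl; unfold mult, Re, Im, Cconj; simpl.
        ring_simplify; rewrite !(Rmult_comm _ (fst v ^ 2)), <- !Rmult_assoc.
        nra.
    - intros x Hx; rewrite E0; apply Hmax, Hin, Hx. }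
  (* The directions 1 and i have opposite squares, so the terms with chi'' cancel in the sum and 2
     |chi'|^2 + 2 dl <= 0 remains. *)
  pose proof (Hdir 1 Cmod_1) as D1; pose proof (Hdir Ci Cmod_Ci) as D2.
  assert (0 <= (fst (chi' z0)) ^ 2 + snd (chi' z0) ^ 2) by nra.
  unfold Re, Im, Cconj in D1, D2; simpl in D1, D2; nra.
Qed.

(** * Schwarz and Schwarz-Pick lemmas *)

(** Two complex derivatives are what the second derivative test consumes, and the class is closed
    under products and inverses, so auxiliary quotients stay inside it. *)
Definition hol2 (U : C -> Prop) (f : C -> C) : Prop :=
  exists f' f'' : C -> C, forall z, U z ->
    cderiv f z (f' z) /\ cderiv f' z (f'' z).

Lemma hol2_const U (c : C) : hol2 U (fun _ => c).
Proof.
  exists (fun _ => RtoC 0), (fun _ => RtoC 0); intros z _.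
  split; apply cderiv_const.
Qed.

Lemma hol2_id U : hol2 U (fun z => z).
Proof.
  exists (fun _ => RtoC 1), (fun _ => RtoC 0); intros z _.
  split; [apply cderiv_id|apply cderiv_const].
Qed.

Lemma hol2_minus U f g : hol2 U f -> hol2 U g -> hol2 U (fun z => f z - g z)%C.
Proof.
  intros (f1 & f2 & Hf) (g1 & g2 & Hg).
  exists (fun z => f1 z - g1 z)%C, (fun z => f2 z - g2 z)%C; intros z Hz.
  destruct (Hf z Hz), (Hg z Hz); split; now apply cderiv_minus.
Qed.

Lemma hol2_mult U f g : hol2 U f -> hol2 U g -> hol2 U (fun z => f z * g z)%C.
Proof.
  intros (f1 & f2 & Hf) (g1 & g2 & Hg).
  exists (fun z => f1 z * g z + f z * g1 z)%C,
    (fun z => (f2 z * g z + f1 z * g1 z) + (f1 z * g1 z + f z * g2 z))%C.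
  intros z Hz; destruct (Hf z Hz), (Hg z Hz); split.
  - now apply cderiv_mult.
  - apply cderiv_plus; now apply cderiv_mult.
Qed.

Lemma hol2_inv U f : hol2 U f -> (forall z, U z -> f z <> 0) ->
  hol2 U (fun z => / f z)%C.
Proof.
  intros (f1 & f2 & Hf) H0.
  exists (fun z => RtoC (-1) * (f1 z * (/ f z * / f z)))%C.
  eexists; intros z Hz; destruct (Hf z Hz) as [D1 D2].
  pose proof (cderiv_inv _ _ _ D1 (H0 z Hz)) as Di; split.
  - refine (cderiv_eq _ _ _ _ _ Di); ring.
  - refine (cderiv_scal _ _ _ _
      (cderiv_mult _ _ _ _ _ D2 (cderiv_mult _ _ _ _ _ Di Di))).
Qed.

Lemma hol2_pow U f n : hol2 U f -> hol2 U (fun z => f z ^ n)%C.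
Proof.
  intros Hf; induction n as [|n IH].
  - exact (hol2_const U (RtoC 1)).
  - exact (hol2_mult U f _ Hf IH).
Qed.

Lemma hol2_sub (U V : C -> Prop) f :
  (forall z, U z -> V z) -> hol2 V f -> hol2 U f.
Proof. intros H (f1 & f2 & Hf); exists f1, f2; auto. Qed.

Lemma hol2_ccont U f z : hol2 U f -> U z -> ccont f z.
Proof.
  intros (f1 & f2 & Hf) Hz; destruct (Hf z Hz) as [D _].
  exact (cderiv_ccont _ _ _ D).
Qed.

Lemma ccont_pow f z n : ccont f z -> ccont (fun w => f w ^ n)%C z.
Proof.
  intros Hf; induction n as [|n IH]; [exact (ccont_const (RtoC 1) z)|].
  exact (ccont_mult f _ z Hf IH).
Qed.

Lemma ccont_conj f z : ccont f z -> ccont (fun w => Cconj (f w)) z.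
Proof.
  intros Hf e He; destruct (Hf e He) as (d & Hd & H).
  exists d; split; auto; intros w Hw.
  rewrite <- Cminus_conj, Cmod_conj; auto.
Qed.

Lemma Cminus_neq_0 (z w : C) : z <> w -> (z - w <> 0)%C.
Proof.
  intros H E; apply H; replace z with (z - w + w)%C by ring; rewrite E; ring.
Qed.

(* The maximum principle is applied to [w^(n+1) / (z - c)^n], which is
   continuous at the centre c with value 0 and holomorphic elsewhere; this
   avoids removing the singularity of [w / (z - c)]. *)
Lemma schwarz_power (w : C -> C) (c : C) (s : R) (n : nat) : 0 < s ->
  hol2 (fun z => Cmod (z - c) <= s) w ->
  (forall z, Cmod (z - c) <= s -> Cmod (w z) <= 1) -> w c = 0 ->
  forall z, Cmod (z - c) <= s -> s ^ n * Cmod (w z) ^ S n <= Cmod (z - c) ^ n.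
Proof.
  intros Hs Hol Hle Hwc.
  assert (Hcc : Cmod (c - c) <= s) by (rewrite Cmod_minus_self; lra).
  set (chi := fun z => (w z ^ S n * (/ (z - c)) ^ n)%C).
  (* The factor [w c = 0] makes this true whatever value [/ 0] has. *)
  assert (Hchic : chi c = 0).
  { unfold chi; rewrite Hwc, Cpow_S; ring. }
  assert (Hchi : hol2 (fun z => Cmod (z - c) <= s /\ z <> c) chi).
  { apply hol2_mult; apply hol2_pow.
    - apply hol2_sub with (2 := Hol); tauto.
    - apply hol2_inv.
      + apply hol2_minus; [apply hol2_id|apply hol2_const].
      + intros z [_ Hz]; now apply Cminus_neq_0. }
  assert (Hcont : forall z, Cmod (z - c) <= s -> ccont chi z).
  { intros z Hz; destruct (classic (z = c)) as [->|Hne].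
    - destruct Hol as (w1 & w2 & Hw); destruct (Hw c Hcc) as [(q & Hq & _ & E) _].
      (* Substituting w = q (z - c) cancels n of the n + 1 factors z - c; the one that is left
         forces continuity at c. *)
      apply ccont_ext with (fun z => q z ^ S n * (z + - c))%C.
      + intros t; unfold chi; rewrite (E t), Hwc.
        destruct (classic (t = c)) as [->|Ht].
        * rewrite Cpow_S; replace (c + - c)%C with (RtoC 0) by ring.
          replace (c - c)%C with (RtoC 0) by ring; rewrite (Cpow_S _ n); ring.
        * replace (0 + q t * (t - c))%C with (q t * (t - c))%C by ring.
          rewrite Cpow_mult_l, (Cpow_S (t - c)).
          transitivity (q t ^ S n * (t - c) * ((t - c) * / (t - c)) ^ n)%C.
          -- rewrite Cinv_r by now apply Cminus_neq_0.
             rewrite Cpow_1_l; ring.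
          -- rewrite Cpow_mult_l; ring.
      + apply ccont_mult; [now apply ccont_pow|].
        apply ccont_plus; [apply ccont_id|apply ccont_const].
    - apply (hol2_ccont _ _ _ Hchi); auto. }
  (* The term dl |z - c|^2 makes the Laplacian strictly positive, so the maximum sits on the circle,
     where |w| <= 1 bounds |chi| by 1 / s^n. *)
  assert (Hbd : forall z dl, Cmod (z - c) <= s -> 0 < dl ->
    Cmod (chi z) ^ 2 <= (/ s ^ n) ^ 2 + dl * s ^ 2).
  { intros z dl Hz Hdl.
    destruct (lsc_attains_min
      (fun z => - (Cmod (chi z) ^ 2 + dl * Cmod (z - c) ^ 2)) c s)
      as (z0 & Hz0 & Hmin); [lra| |].
    { intros t Ht e He.
      assert (Hc : ccont (fun z => chi z * Cconj (chi z)
        + RtoC dl * ((z + - c) * Cconj (z + - c)))%C t).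
      { assert (Hid : ccont (fun z => z + - c)%C t)
          by (apply ccont_plus; [apply ccont_id|apply ccont_const]).
        apply ccont_plus; apply ccont_mult; auto using ccont_conj, ccont_const.
        apply ccont_mult; auto; now apply ccont_conj. }
      destruct (Hc e He) as (d & Hd & H); exists d; split; auto.
      intros u _ Hu; specialize (H u Hu).
      apply (Rle_lt_trans _ _ _ (re_le_Cmod _)) in H.
      apply Rabs_def2 in H; revert H; rewrite !Cmod2_alt.
      unfold Re, Im, Cconj; simpl; intros [H _]; lra. }
    assert (Hmax : forall z, Cmod (z - c) <= s ->
      Cmod (chi z) ^ 2 + dl * Cmod (z - c) ^ 2
      <= Cmod (chi z0) ^ 2 + dl * Cmod (z0 - c) ^ 2).
    { intros t Ht; specialize (Hmin t Ht); lra. }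
    destruct (Rle_lt_or_eq_dec _ _ Hz0) as [Hlt|Heq].
    - exfalso; destruct (classic (z0 = c)) as [->|Hne].
      (* Differentiability of chi is known only off c, but a maximum at c is absurd: the value there
         is 0, while at the point c + s it is at least dl s^2. *)
      + specialize (Hmax (c + RtoC s)%C).
        replace (c + RtoC s - c)%C with (RtoC s) in Hmax by ring.
        rewrite Hchic, Cmod_minus_self, Cmod_0, Cmod_R, Rabs_pos_eq in Hmax
          by lra.
        pose proof (pow2_ge_0 (Cmod (chi (c + RtoC s)%C))).
        assert (0 < dl * s ^ 2) by (apply Rmult_lt_0_compat, pow_lt; lra).
        specialize (Hmax (Rle_refl s)); lra.
      + destruct Hchi as (chi1 & chi2 & Hd).
        assert (Hpos : 0 < Cmod (z0 - c))
          by now apply Cmod_gt_0, Cminus_neq_0.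
        assert (Hin : forall t,
          Cmod (t - z0) < Rmin (s - Cmod (z0 - c)) (Cmod (z0 - c)) ->
          Cmod (t - c) <= s /\ t <> c).
        { intros t Ht.
          pose proof (Rmin_l (s - Cmod (z0 - c)) (Cmod (z0 - c))).
          pose proof (Rmin_r (s - Cmod (z0 - c)) (Cmod (z0 - c))).
          pose proof (Cmod_minus_triangle t z0 c).
          split; [lra|]; intros ->; rewrite Cmod_minus_sym in Ht; lra. }
        refine (no_interior_max chi chi1 (chi2 z0) z0 c dl
          (Rmin (s - Cmod (z0 - c)) (Cmod (z0 - c))) Hdl _ _ _ _).
        * apply Rmin_glb_lt; lra.
        * intros t Ht; now apply Hd, Hin.
        * now apply Hd.
        * intros t Ht; now apply Hmax, Hin.
    - specialize (Hmax z Hz); rewrite Heq in Hmax.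
      assert (Hz0c : z0 <> c).
      { intros ->; rewrite Cmod_minus_self in Heq; lra. }
      assert (Hchi0 : Cmod (chi z0) <= / s ^ n).
      { unfold chi.
        rewrite Cmod_mult, !Cmod_pow, Cmod_inv by now apply Cminus_neq_0.
        rewrite Heq, pow_inv; rewrite <- (Rmult_1_l (/ s ^ n)) at 2.
        apply Rmult_le_compat_r.
        - left; now apply Rinv_0_lt_compat, pow_lt.
        - rewrite <- (pow1 (S n)); apply pow_incr; split; [apply Cmod_ge_0|].
          apply Hle; lra. }
      assert (Cmod (chi z0) ^ 2 <= (/ s ^ n) ^ 2).
      { apply pow_incr; split; [apply Cmod_ge_0|auto]. }
      pose proof (pow2_ge_0 (Cmod (z - c))); nra. }
  intros z Hz.
  assert (Hsn : 0 < s ^ n) by now apply pow_lt.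
  assert (Hinv : Cmod (chi z) <= / s ^ n).
  { destruct (Rle_lt_dec (Cmod (chi z)) (/ s ^ n)) as [H|H]; auto; exfalso.
    assert (0 < / s ^ n) by now apply Rinv_0_lt_compat.
    set (D := Cmod (chi z) ^ 2 - (/ s ^ n) ^ 2).
    assert (HD : 0 < D) by (unfold D; nra).
    assert (Hs2 : 0 < s ^ 2) by now apply pow_lt.
    (* This dl makes the perturbation on the circle half of the supposed excess D. *)
    assert (Hp : 0 < D / (2 * s ^ 2)) by (apply Rdiv_lt_0_compat; lra).
    pose proof (Hbd z _ Hz Hp) as Hb.
    replace (D / (2 * s ^ 2) * s ^ 2) with (D / 2) in Hb by (field; lra).
    unfold D in Hb, HD; lra. }
  destruct (classic (z = c)) as [->|Hne].
  { rewrite Hwc, Cmod_0, pow_i by lia; rewrite Rmult_0_r.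
    apply pow_le, Cmod_ge_0. }
  assert (Hpos : 0 < Cmod (z - c)) by now apply Cmod_gt_0, Cminus_neq_0.
  assert (Hpn : 0 < Cmod (z - c) ^ n) by now apply pow_lt.
  unfold chi in Hinv.
  rewrite Cmod_mult, !Cmod_pow, Cmod_inv, pow_inv in Hinv
    by now apply Cminus_neq_0.
  apply Rmult_le_compat_r with (r := s ^ n * Cmod (z - c) ^ n) in Hinv;
    [|nra].
  replace (/ s ^ n * (s ^ n * Cmod (z - c) ^ n)) with (Cmod (z - c) ^ n)
    in Hinv by (field; lra).
  replace (s ^ n * Cmod (w z) ^ S n) with
    (Cmod (w z) ^ S n * / Cmod (z - c) ^ n * (s ^ n * Cmod (z - c) ^ n))
    by (field; lra).
  exact Hinv.
Qed.

(** If b < a, then (b/a)^n tends to 0 and falls below a. As n grows, the surplus exponent of the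
    power trick costs nothing in the limit. *)
Lemma le_of_pow_le (a b : R) : 0 < a -> 0 <= b ->
  (forall n, a ^ S n <= b ^ n) -> a <= b.
Proof.
  intros Ha Hb H.
  destruct (Rle_lt_dec a b) as [Hab|Hab]; auto; exfalso.
  assert (Hq : Rabs (b / a) < 1).
  { rewrite Rabs_pos_eq.
    - apply Rlt_div_l; lra.
    - apply Rdiv_le_0_compat; lra. }
  destruct (pow_lt_1_zero (b / a) Hq a Ha) as [N HN].
  specialize (HN N (Nat.le_refl N)); specialize (H N).
  assert (Hp : 0 < a ^ N) by now apply pow_lt.
  pose proof (Rle_abs ((b / a) ^ N)) as Hle.
  assert (Hlt : (b / a) ^ N < a) by lra.
  unfold Rdiv in Hlt; rewrite Rpow_mult_distr, pow_inv in Hlt.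
  apply Rlt_div_l in Hlt; [|lra].
  simpl in H; lra.
Qed.

Lemma le_of_pow_le_scaled (a b s : R) : 0 <= a -> 0 <= b -> 0 < s ->
  (forall n, s ^ n * a ^ S n <= b ^ n) -> s * a <= b.
Proof.
  intros Ha Hb Hs H.
  destruct (Rle_lt_or_eq_dec _ _ Ha) as [Ha'|<-]; [|lra].
  assert (a <= b / s).
  { apply le_of_pow_le; auto.
    - now apply Rdiv_le_0_compat.
    - intros n; unfold Rdiv; rewrite Rpow_mult_distr, pow_inv.
      apply (Rle_div_r (a ^ S n)); [now apply pow_lt|].
      rewrite Rmult_comm; apply H. }
  apply Rle_div_r in H0; lra.
Qed.

(** The power estimate gives the claim on each closed disc of radius s < r once n tends to infinity;
    then s tends to r. *)
Lemma schwarz (w : C -> C) (c : C) (r : R) :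
  hol2 (fun z => Cmod (z - c) < r) w ->
  (forall z, Cmod (z - c) < r -> Cmod (w z) <= 1) -> w c = 0 ->
  forall z, Cmod (z - c) < r -> r * Cmod (w z) <= Cmod (z - c).
Proof.
  intros Hol Hle Hwc z Hz.
  pose proof (Cmod_ge_0 (z - c)) as Hm; pose proof (Cmod_ge_0 (w z)) as Hw.
  destruct (Rle_lt_dec (r * Cmod (w z)) (Cmod (z - c))) as [H|H]; auto.
  assert (Hall : forall s, Cmod (z - c) <= s -> 0 < s < r ->
    s * Cmod (w z) <= Cmod (z - c)).
  { intros s Hzs Hs; apply le_of_pow_le_scaled; auto; [lra|]; intros n.
    apply schwarz_power; auto; [lra| |].
    - apply hol2_sub with (2 := Hol); intros; lra.
    - intros t Ht; apply Hle; lra. }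
  assert (Hw' : 0 < Cmod (w z)) by nra.
  set (D := r - Cmod (z - c) / Cmod (w z)).
  assert (HD : Cmod (z - c) = (r - D) * Cmod (w z)) by (unfold D; field; lra).
  assert (HD0 : 0 < D) by nra.
  set (s := Rmax (Cmod (z - c)) (r - D / 2)).
  assert (r - D / 2 <= s) by apply Rmax_r.
  assert (Cmod (z - c) <= s) by apply Rmax_l.
  assert (s < r) by (apply Rmax_lub_lt; lra).
  assert (0 <= r - D) by nra.
  assert (s * Cmod (w z) <= Cmod (z - c)) by (apply Hall; lra).
  nra.
Qed.

Lemma Rle_of_eps_scaled (x y k : R) :
  (forall e, 0 < e <= 1 -> x <= y + e * k) -> x <= y.
Proof.
  intros H; destruct (Rle_lt_dec x y) as [Hxy|Hxy]; auto; exfalso.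
  pose proof (Rabs_pos k) as Hk; pose proof (Rle_abs k) as Hk'.
  set (e := Rmin 1 ((x - y) / (2 * (Rabs k + 1)))).
  assert (He : 0 < e).
  { apply Rmin_glb_lt; [lra|]; apply Rdiv_lt_0_compat; lra. }
  assert (He1 : e <= 1) by apply Rmin_l.
  assert (He2 : e * (2 * (Rabs k + 1)) <= x - y)
    by (apply Rle_div_r; [lra|apply Rmin_r]).
  specialize (H e (conj He He1)).
  assert (e * k <= e * Rabs k) by (apply Rmult_le_compat_l; lra).
  nra.
Qed.

Lemma Cmod_le_of_sqr (a b : C) : Cmod a ^ 2 <= Cmod b ^ 2 -> Cmod a <= Cmod b.
Proof.
  intros H; pose proof (Cmod_ge_0 a); pose proof (Cmod_ge_0 b).
  apply Rnot_lt_le; intros Hlt; nra.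
Qed.

(** The second point is the mirror image of w0 in the line Re = m, and w lies on the same side as
    w0. *)
Lemma Cmod_half_plane (w w0 : C) (m : R) : Re w < m -> Re w0 < m ->
  Cmod (w - w0) <= Cmod (w - (RtoC (2 * m) - Cconj w0)).
Proof.
  intros Hw Hw0; apply Cmod_le_of_sqr; rewrite !Cmod2_alt.
  unfold Re, Im, Cconj in *; simpl; nra.
Qed.

(** The map w -> (w - h(z0)) / (w - b), with b the mirror image of h(z0), carries the half plane
    into the unit disc. Schwarz bounds the difference quotient at z by |h(z) - b| / s, and z -> z0
    gives the derivative, as |h(z0) - b| = 2 (m - Re h(z0)). *)
Lemma half_plane_derivative_bound (h : C -> C) (z0 l : C) (s m : R) : 0 < s ->
  hol2 (fun z => Cmod (z - z0) < s) h -> cderiv h z0 l ->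
  (forall z, Cmod (z - z0) < s -> Re (h z) < m) ->
  s * Cmod l <= 2 * (m - Re (h z0)).
Proof.
  intros Hs Hol Hd Hm.
  assert (Hz0 : Cmod (z0 - z0) < s) by now rewrite Cmod_minus_self.
  set (b := (RtoC (2 * m) - Cconj (h z0))%C).
  assert (Hden : forall z, Cmod (z - z0) < s -> (h z - b <> 0)%C).
  { intros z Hz E; apply (f_equal Re) in E.
    pose proof (Hm z Hz); pose proof (Hm z0 Hz0).
    unfold b, Re, Cconj in *; simpl in *; lra. }
  assert (Hsch : forall z, Cmod (z - z0) < s ->
    s * Cmod ((h z - h z0) * / (h z - b)) <= Cmod (z - z0)).
  { apply (schwarz (fun z => (h z - h z0) * / (h z - b))%C).
    - apply hol2_mult; [|apply hol2_inv; auto];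
        apply hol2_minus; auto; apply hol2_const.
    - intros z Hz; specialize (Hden z Hz).
      rewrite Cmod_mult, Cmod_inv by auto.
      apply Cmod_gt_0 in Hden.
      apply Rle_div_l; [auto|]; rewrite Rmult_1_l.
      apply Cmod_half_plane; auto.
    - ring. }
  pose proof (cderiv_ccont _ _ _ Hd) as Hhc.
  destruct Hd as (q & Hq & <- & E).
  replace (2 * (m - Re (h z0))) with (Cmod (h z0 - b)).
  2:{ replace (h z0 - b)%C with (RtoC (- (2 * (m - Re (h z0)))))
        by (unfold b, Cconj; C_ring).
      rewrite Cmod_R, Rabs_Ropp, Rabs_pos_eq; auto.
      specialize (Hm z0 Hz0); lra. }
  (* The error e comes from |h(z) - h(z0)|, the error s e from the difference quotient q. *)
  apply Rle_of_eps_scaled with (1 + s); intros e He.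
  destruct (Hq e) as (d1 & Hd1 & H1); [lra|].
  destruct (Hhc e) as (d2 & Hd2 & H2); [lra|].
  set (t := Rmin s (Rmin d1 d2) / 2).
  assert (Hmin : 0 < Rmin s (Rmin d1 d2)) by (repeat apply Rmin_glb_lt; lra).
  pose proof (Rmin_l s (Rmin d1 d2)); pose proof (Rmin_r s (Rmin d1 d2)).
  pose proof (Rmin_l d1 d2); pose proof (Rmin_r d1 d2).
  set (z := (z0 + RtoC t)%C).
  assert (Hz : Cmod (z - z0) = t).
  { unfold z; replace (z0 + RtoC t - z0)%C with (RtoC t) by ring.
    rewrite Cmod_R, Rabs_pos_eq; unfold t; lra. }
  assert (Ht : 0 < t) by (unfold t; lra).
  specialize (H1 z); specialize (H2 z); specialize (Hsch z); specialize (Hden z).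
  rewrite Hz in *.
  assert (Hts : t < s) by (unfold t; lra).
  assert (Ht1 : t < d1) by (unfold t; lra).
  assert (Ht2 : t < d2) by (unfold t; lra).
  specialize (H1 Ht1); specialize (H2 Ht2); specialize (Hsch Hts).
  specialize (Hden Hts).
  replace (h z - h z0)%C with (q z * (z - z0))%C in Hsch
    by (rewrite (E z) at 1; ring).
  rewrite !Cmod_mult, Hz, Cmod_inv in Hsch by auto.
  apply Cmod_gt_0 in Hden.
  assert (Hqz : s * Cmod (q z) <= Cmod (h z - b)).
  { apply Rmult_le_reg_r with (t * / Cmod (h z - b)).
    - apply Rmult_lt_0_compat; auto; now apply Rinv_0_lt_compat.
    - replace (Cmod (h z - b) * (t * / Cmod (h z - b))) with t by (field; lra).
      lra. }
  rewrite Cmod_minus_sym in H1.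
  pose proof (Cmod_le_diff (q z0) (q z)) as H5.
  pose proof (Cmod_minus_triangle (h z) (h z0) b) as H6.
  assert (s * Cmod (q z0) <= s * (Cmod (q z) + e))
    by (apply Rmult_le_compat_l; lra).
  lra.
Qed.

Lemma Cmod_pick_denominator (L : R) (p a : C) : Cmod p < L -> Cmod a < L ->
  (RtoC (L ^ 2) - Cconj a * p <> 0)%C.
Proof.
  intros Hp Ha E.
  pose proof (Cmod_le_diff (RtoC (L ^ 2)) (Cconj a * p)) as H.
  pose proof (Cmod_ge_0 p); pose proof (Cmod_ge_0 a).
  rewrite E, Cmod_0, Cmod_R, Cmod_mult, Cmod_conj, Rabs_pos_eq in H by nra.
  nra.
Qed.

(* [|L^2 - conj a p|^2 - L^2 |p - a|^2 = (L^2 - |p|^2) (L^2 - |a|^2)] *)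
Lemma Cmod_pick_le (L : R) (p a : C) : Cmod p < L -> Cmod a < L ->
  Cmod (RtoC L * (p - a)) <= Cmod (RtoC (L ^ 2) - Cconj a * p).
Proof.
  intros Hp Ha; apply Cmod_le_of_sqr.
  pose proof (Cmod_ge_0 p); pose proof (Cmod_ge_0 a).
  assert (H1 : 0 <= (L ^ 2 - Cmod p ^ 2) * (L ^ 2 - Cmod a ^ 2))
    by (apply Rmult_le_pos; nra).
  revert H1; rewrite !Cmod2_alt; unfold Re, Im, Cconj; simpl; lra.
Qed.

(** Schwarz's lemma after the map v -> L (v - p(0)) / (L^2 - conj p(0) v), which takes the disc of
    radius L to the unit disc and p(0) to 0. *)
Lemma schwarz_pick_hol2 (p : C -> C) (r L : R) : 0 < r ->
  hol2 (fun z => Cmod z < r) p -> (forall z, Cmod z < r -> Cmod (p z) < L) ->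
  forall z, Cmod z < r ->
    r * L * Cmod (p z - p 0) <= Cmod z * Cmod (RtoC (L ^ 2) - Cconj (p 0) * p z).
Proof.
  intros Hr Hol Hlt z Hz.
  assert (E0 : forall z : C, (z - 0 = z)%C) by (intros; ring).
  assert (H0 : Cmod (p 0) < L) by (apply Hlt; rewrite Cmod_0; lra).
  set (D := fun z => (RtoC (L ^ 2) - Cconj (p 0) * p z)%C).
  assert (HD : forall t, Cmod t < r -> D t <> 0)
    by (intros; apply Cmod_pick_denominator; auto).
  assert (Hs : r * Cmod (RtoC L * (p z - p 0) * / D z) <= Cmod (z - 0)).
  { apply (schwarz (fun z => RtoC L * (p z - p 0) * / D z)%C).
    - apply hol2_sub with (V := fun z => Cmod z < r).
      { intros t; now rewrite E0. }
      apply hol2_mult; [|apply hol2_inv; auto].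
      + apply hol2_mult; [apply hol2_const|].
        apply hol2_minus; auto; apply hol2_const.
      + apply hol2_minus; [apply hol2_const|].
        apply hol2_mult; auto; apply hol2_const.
    - intros t; rewrite E0; intros Ht.
      rewrite Cmod_mult, Cmod_inv by auto.
      pose proof (proj1 (Cmod_gt_0 _) (HD t Ht)).
      apply Rle_div_l; [auto|]; rewrite Rmult_1_l.
      apply Cmod_pick_le; auto.
    - ring.
    - now rewrite E0. }
  pose proof (Cmod_ge_0 (p 0)).
  rewrite E0, !Cmod_mult, Cmod_inv, Cmod_R, (Rabs_pos_eq L) in Hs by (auto; lra).
  pose proof (proj1 (Cmod_gt_0 _) (HD z Hz)) as HDz.
  fold (D z).
  apply Rmult_le_compat_r with (r := Cmod (D z)) in Hs; [|lra].
  eapply Rle_trans; [right|exact Hs]; field; lra.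
Qed.

(** With the conjugate of the increment as weight, the left side of the mean value formula is the
    square of its modulus. *)
Lemma C_segment_increment (f f' : C -> C) (a b : C) :
  (forall t, 0 <= t <= 1 ->
     cderiv f (a + RtoC t * (b - a))%C (f' (a + RtoC t * (b - a))%C)) ->
  exists t, 0 <= t <= 1 /\
    Cmod (f b - f a) <= Cmod (f' (a + RtoC t * (b - a))%C) * Cmod (b - a).
Proof.
  intros H.
  destruct (C_segment_mean_value f f' a b (Cconj (f b - f a)) H) as (t & Ht & E).
  exists t; split; auto.
  set (D := (f b - f a)%C) in *.
  assert (ED : Re (Cconj D * D)%C = Cmod D * Cmod D).
  { replace (Cmod D * Cmod D) with (Cmod D ^ 2) by ring.
    rewrite Cmod2_alt; unfold Re, Im, Cconj; simpl; ring. }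
  rewrite ED in E.
  pose proof (Rle_abs (Re (Cconj D * f' (a + RtoC t * (b - a)) * (b - a))%C)) as H1.
  pose proof (re_le_Cmod (Cconj D * f' (a + RtoC t * (b - a)) * (b - a))%C) as H2.
  rewrite !Cmod_mult, Cmod_conj in H2.
  pose proof (Cmod_ge_0 D) as H3.
  destruct (Rle_lt_or_eq_dec _ _ H3) as [H4|<-].
  - apply Rmult_le_reg_l with (Cmod D); lra.
  - apply Rmult_le_pos; apply Cmod_ge_0.
Qed.

(* phi is only known to be once differentiable, but its primitive Phi is twice
   differentiable, hence so are the difference quotients of Phi. *)
Lemma schwarz_pick (Phi phi phi' : C -> C) (r L : R) :
  (forall z, Cmod z < r -> cderiv Phi z (phi z) /\ cderiv phi z (phi' z)) ->
  (forall z, Cmod z < r -> Cmod (phi z) < L) ->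
  forall z, Cmod z < r ->
    r * L * Cmod (phi z - phi 0)
    <= Cmod z * Cmod (RtoC (L ^ 2) - Cconj (phi 0) * phi z).
Proof.
  intros Hd Hlt z Hz.
  pose proof (Cmod_ge_0 z) as Hz0.
  assert (Hr : Cmod 0 < r) by (rewrite Cmod_0; lra).
  assert (HL : 0 < L)
    by (pose proof (Cmod_ge_0 (phi 0)); specialize (Hlt 0 Hr); lra).
  set (psi := fun (eta : R) (t : C) =>
    (/ RtoC eta * (Phi (t + RtoC eta) - Phi t))%C).
  assert (Hin : forall eta t, 0 < eta -> Cmod t < r - eta ->
    forall u, 0 <= u <= eta -> Cmod (t + RtoC u) < r).
  { intros eta t He Ht u Hu.
    pose proof (Cmod_triangle t (RtoC u)) as H.
    rewrite Cmod_R, Rabs_pos_eq in H; lra. }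
  assert (Hpsi : forall eta t, 0 < eta -> Cmod t < r - eta ->
    Cmod (psi eta t) < L).
  { intros eta t He Ht.
    assert (Eq : (t + RtoC eta - t = RtoC eta)%C) by ring.
    destruct (C_segment_increment Phi phi t (t + RtoC eta)) as (u & Hu & Hi).
    { intros u Hu; rewrite Eq, <- RtoC_mult; apply Hd.
      apply Hin with eta; auto; nra. }
    rewrite Eq, <- RtoC_mult, Cmod_R, (Rabs_pos_eq eta) in Hi by lra.
    assert (Hl : Cmod (phi (t + RtoC (u * eta))%C) < L).
    { apply Hlt, Hin with eta; auto; nra. }
    unfold psi; rewrite Cmod_mult, Cmod_inv, Cmod_R, Rabs_pos_eq;
      [|lra|apply Cmod_gt_0; rewrite Cmod_R, Rabs_pos_eq; lra].
    rewrite Rmult_comm; apply Rlt_div_l; [auto|]; nra. }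
  assert (Hhol : forall eta, 0 < eta ->
    hol2 (fun t => Cmod t < r - eta) (psi eta)).
  { intros eta He; apply hol2_mult; [apply hol2_const|].
    exists (fun t => phi (t + RtoC eta) - phi t)%C,
      (fun t => phi' (t + RtoC eta) - phi' t)%C; intros t Ht.
    destruct (Hd (t + RtoC eta)%C) as [A1 A2]; [apply Hin with eta; auto; lra|].
    destruct (Hd t) as [B1 B2]; [lra|].
    split; apply cderiv_minus; auto.
    - now apply (cderiv_comp_translate Phi).
    - now apply (cderiv_comp_translate phi). }
  assert (Happ : forall t e, Cmod t < r -> 0 < e -> exists d, 0 < d /\
    forall eta, 0 < eta < d -> Cmod (psi eta t - phi t) <= e).
  { intros t e Ht He; destruct (Hd t Ht) as [A1 _]; rewrite cderivP in A1.
    destruct (A1 e He) as (d & Hdp & H); exists d; split; auto.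
    intros eta Heta; specialize (H (t + RtoC eta)%C).
    replace (t + RtoC eta - t)%C with (RtoC eta) in H by ring.
    rewrite Cmod_R, Rabs_pos_eq in H by lra; specialize (H (proj2 Heta)).
    assert (Hn : RtoC eta <> 0)
      by (apply Cmod_gt_0; rewrite Cmod_R, Rabs_pos_eq; lra).
    replace (psi eta t - phi t)%C with
      (/ RtoC eta * (Phi (t + RtoC eta) - Phi t - phi t * RtoC eta))%C
      by (unfold psi; field; auto).
    rewrite Cmod_mult, Cmod_inv, Cmod_R, Rabs_pos_eq by (auto; lra).
    rewrite Rmult_comm; apply Rle_div_l; lra. }
  (* Replacing phi by its difference quotient costs 2 r L e on each side of the inequality;
     shrinking the radius from r to r - eta costs at most 2 L^2 e, since eta < e and |p - a| <= 2
     L. *)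
  apply Rle_of_eps_scaled with (4 * r * L + 2 * L ^ 2); intros e He.
  destruct (Happ z e Hz (proj1 He)) as (d1 & Hd1 & H1).
  destruct (Happ 0 e Hr (proj1 He)) as (d2 & Hd2 & H2).
  set (eta := Rmin (Rmin d1 d2) (Rmin e (r - Cmod z)) / 2).
  assert (Heta : 0 < eta /\ eta < d1 /\ eta < d2 /\ eta < e
                 /\ eta < r - Cmod z).
  { pose proof (Rmin_l (Rmin d1 d2) (Rmin e (r - Cmod z))).
    pose proof (Rmin_r (Rmin d1 d2) (Rmin e (r - Cmod z))).
    pose proof (Rmin_l d1 d2); pose proof (Rmin_r d1 d2).
    pose proof (Rmin_l e (r - Cmod z)); pose proof (Rmin_r e (r - Cmod z)).
    assert (0 < Rmin (Rmin d1 d2) (Rmin e (r - Cmod z)))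
      by (repeat apply Rmin_glb_lt; lra).
    unfold eta; lra. }
  clearbody eta; destruct Heta as (E1 & E2 & E3 & E4 & E5).
  specialize (H1 eta (conj E1 E2)); specialize (H2 eta (conj E1 E3)).
  assert (Hre : 0 < r - eta) by lra.
  assert (Hze : Cmod z < r - eta) by lra.
  pose proof (schwarz_pick_hol2 (psi eta) (r - eta) L Hre (Hhol eta E1)
    (fun t Ht => Hpsi eta t E1 Ht) z Hze) as Hsp.
  assert (B1 : Cmod (psi eta z) < L) by (apply Hpsi; lra).
  assert (B2 : Cmod (psi eta 0) < L) by (apply Hpsi; rewrite ?Cmod_0; lra).
  specialize (Hlt z Hz) as B3; specialize (Hlt 0 Hr) as B4.
  set (p := psi eta z) in *; set (a := psi eta 0) in *.
  set (p0 := phi z) in *; set (a0 := phi 0) in *.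
  assert (T1 : Cmod (p0 - a0) <= Cmod (p - a) + 2 * e).
  { pose proof (Cmod_minus_triangle p0 p a0).
    pose proof (Cmod_minus_triangle p a a0).
    rewrite (Cmod_minus_sym p0 p) in *; lra. }
  assert (T2 : Cmod (RtoC (L ^ 2) - Cconj a * p)
               <= Cmod (RtoC (L ^ 2) - Cconj a0 * p0) + 2 * L * e).
  { replace (RtoC (L ^ 2) - Cconj a * p)%C with
      ((RtoC (L ^ 2) - Cconj a0 * p0)
       - (Cconj a * (p - p0) + Cconj (a - a0) * p0))%C
      by (rewrite Cminus_conj; ring).
    eapply Rle_trans; [apply Cmod_triangle|].
    rewrite Cmod_opp; apply Rplus_le_compat_l.
    eapply Rle_trans; [apply Cmod_triangle|].
    rewrite !Cmod_mult, !Cmod_conj.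
    pose proof (Cmod_ge_0 (p - p0)); pose proof (Cmod_ge_0 (a - a0)).
    pose proof (Cmod_ge_0 p0); pose proof (Cmod_ge_0 a).
    nra. }
  assert (T3 : Cmod (p - a) <= 2 * L).
  { pose proof (Cmod_triangle p (- a)) as H; rewrite Cmod_opp in H.
    change (Cmod (p - a) <= Cmod p + Cmod a) in H; lra. }
  pose proof (Cmod_ge_0 (p - a)).
  assert (S1 : r * L * Cmod (p0 - a0) <= r * L * (Cmod (p - a) + 2 * e))
    by (apply Rmult_le_compat_l; [nra|auto]).
  assert (S2 : Cmod z * Cmod (RtoC (L ^ 2) - Cconj a * p)
    <= Cmod z * (Cmod (RtoC (L ^ 2) - Cconj a0 * p0) + 2 * L * e))
    by (apply Rmult_le_compat_l; auto).
  assert (S3 : Cmod z * (2 * L * e) <= r * (2 * L * e))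
    by (apply Rmult_le_compat_r; nra).
  assert (S4 : eta * L * Cmod (p - a) <= e * L * (2 * L)).
  { apply Rmult_le_compat; auto; nra. }
  nra.
Qed.

(* Taking the real part relative to the value a at the centre; the bound is
   increasing in |a|, hence may be evaluated at |a| = 1. *)
Lemma pick_real_part (L t : R) (p a : C) : 0 <= t < 1 ->
  Cmod p < L -> Cmod a < L -> 1 <= Cmod a ->
  L * Cmod (p - a) <= t * Cmod (RtoC (L ^ 2) - Cconj a * p) ->
  L * (1 - L * t) / (L - t) <= Re (Cconj a * p)%C / Cmod a.
Proof.
  intros Ht Hp Ha Ha1 H.
  set (al := Cmod a) in *; set (X := Re (Cconj a * p)%C).
  set (Y := Im (Cconj a * p)%C).
  pose proof (Cmod_ge_0 p) as Hp0.
  pose proof (Cmod_ge_0 (p - a)) as Hpa.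
  assert (Hm : Cmod (Cconj a * p) = al * Cmod p)
    by (rewrite Cmod_mult, Cmod_conj; reflexivity).
  assert (HX : X < L ^ 2).
  { pose proof (re_le_Cmod (Cconj a * p)) as H1; fold X in H1.
    pose proof (Rle_abs X); nra. }
  assert (Hsq : (L * Cmod (p - a)) ^ 2
                <= (t * Cmod (RtoC (L ^ 2) - Cconj a * p)) ^ 2)
    by (apply pow_incr; split; [nra|auto]).
  rewrite !Rpow_mult_distr in Hsq.
  replace (Cmod (RtoC (L ^ 2) - Cconj a * p) ^ 2)
    with ((L ^ 2 - X) ^ 2 + Y ^ 2) in Hsq.
  2:{ rewrite Cmod2_alt; unfold X, Y, Re, Im; simpl; ring. }
  (* Multiplication by |a|^2 expresses the whole inequality through conj a p = X + i Y. *)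
  assert (Epa : al ^ 2 * Cmod (p - a) ^ 2 = (X - al ^ 2) ^ 2 + Y ^ 2).
  { unfold al, X, Y; rewrite !Cmod2_alt; unfold Re, Im, Cconj; simpl; ring. }
  assert (Hsq2 : L ^ 2 * ((X - al ^ 2) ^ 2 + Y ^ 2)
                 <= t ^ 2 * al ^ 2 * ((L ^ 2 - X) ^ 2 + Y ^ 2)).
  { rewrite <- Epa.
    replace (L ^ 2 * (al ^ 2 * Cmod (p - a) ^ 2))
      with (al ^ 2 * (L ^ 2 * Cmod (p - a) ^ 2)) by ring.
    replace (t ^ 2 * al ^ 2 * ((L ^ 2 - X) ^ 2 + Y ^ 2))
      with (al ^ 2 * (t ^ 2 * ((L ^ 2 - X) ^ 2 + Y ^ 2))) by ring.
    apply Rmult_le_compat_l; [nra|auto]. }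
  assert (Hta : 0 <= t * al < L) by nra.
  (* Since t |a| < L, the larger coefficient of Y^2 is on the left; dropping Y leaves a comparison
     of two real squares. *)
  assert (HY : 0 <= (L ^ 2 - (t * al) ^ 2) * Y ^ 2)
    by (apply Rmult_le_pos; nra).
  assert (Hsq3 : (L * (al ^ 2 - X)) ^ 2 <= (t * al * (L ^ 2 - X)) ^ 2) by nra.
  assert (Hlin : L * (al ^ 2 - X) <= t * al * (L ^ 2 - X)).
  { assert (0 <= t * al * (L ^ 2 - X)) by (apply Rmult_le_pos; lra).
    apply Rnot_lt_le; intros Hc; nra. }
  assert (Hx : L * (al - L * t) <= X / al * (L - t * al)).
  { apply Rmult_le_reg_l with al; [lra|].
    replace (al * (X / al * (L - t * al))) with (X * (L - t * al))
      by (field; lra).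
    nra. }
  apply Rle_trans with (L * (al - L * t) / (L - t * al)).
  - apply Rle_div_l; [lra|].
    replace (L * (al - L * t) / (L - t * al) * (L - t))
      with (L * (al - L * t) * (L - t) / (L - t * al)) by (field; lra).
    apply (proj1 (Rle_div_r (L * (1 - L * t)) (L * (al - L * t) * (L - t))
      (L - t * al) ltac:(lra))).
    (* This product is the cross-multiplied difference of the bounds at |a| and at 1. *)
    assert (0 <= L ^ 2 * (al - 1) * (1 - t ^ 2)).
    { apply Rmult_le_pos; [apply Rmult_le_pos|]; nra. }
    nra.
  - apply Rle_div_l; lra.
Qed.

(** * Analytic parts of a C^2 harmonic mapping *)

Definition Copen (A : C -> Prop) : Prop :=
  forall z, A z -> exists d, 0 < d /\ forall w, Cmod (w - z) < d -> A w.

Lemma disk_Copen (a : C) (r : R) : Copen (disk a r).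
Proof.
  intros z Hz; unfold disk in *; exists (r - Cmod (z - a)); split; [lra|].
  intros w Hw; pose proof (Cmod_minus_triangle w z a); lra.
Qed.

Lemma Copen_locally_2d (A : C -> Prop) (P : R -> R -> Prop) (x y : R) :
  Copen A -> A (x, y) -> (forall u v, A (u, v) -> P u v) ->
  locally_2d P x y.
Proof.
  intros HA Hxy HP; destruct (HA _ Hxy) as (d & Hd & H).
  assert (Hd2 : 0 < d / 2) by lra.
  exists (mkposreal _ Hd2); simpl; intros u v Hu Hv.
  apply HP, H; eapply Rle_lt_trans; [apply Cmod_le_Re_Im|].
  change (Rabs (u - x) + Rabs (v - y) < d); lra.
Qed.

Lemma ex_diff_n_1_differentiable (A : C -> Prop) (W : R -> R -> R) (x y : R) :
  Copen A -> A (x, y) -> (forall u v, A (u, v) -> ex_diff_n W 1 u v) ->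
  differentiable_pt_lim W x y
    (Derive (fun t => W t y) x) (Derive (fun t => W x t) y).
Proof.
  intros HA Hxy HW.
  apply filterdiff_differentiable_pt_lim.
  apply (is_derive_filterdiff W x y (fun u v => Derive (fun t => W t v) u)).
  - apply (locally_2d_locally
      (fun u v => is_derive (fun t => W t v) u (Derive (fun t => W t v) u))).
    apply Copen_locally_2d with A; auto; intros u v Huv.
    apply Derive_correct; now destruct (HW u v Huv) as (_ & H & _).
  - apply Derive_correct; now destruct (HW x y Hxy) as (_ & _ & H & _).
  - destruct (HW x y Hxy) as (_ & _ & _ & (H & _) & _).
    apply continuity_2d_pt_filterlim in H; exact H.
Qed.

Lemma differentiable_pt_lim_comb (U V : R -> R -> R) (a b x y u1 u2 v1 v2 : R) :
  differentiable_pt_lim U x y u1 u2 -> differentiable_pt_lim V x y v1 v2 ->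
  differentiable_pt_lim (fun s t => a * U s t + b * V s t) x y
    (a * u1 + b * v1) (a * u2 + b * v2).
Proof.
  intros HU HV eps.
  set (k := Rabs a + Rabs b + 1).
  assert (Hk : 0 < k)
    by (unfold k; pose proof (Rabs_pos a); pose proof (Rabs_pos b); lra).
  assert (He : 0 < eps / k) by (apply Rdiv_lt_0_compat; [apply cond_pos|auto]).
  specialize (HU (mkposreal _ He)); specialize (HV (mkposreal _ He)).
  revert HV; apply locally_2d_impl; revert HU; apply locally_2d_impl.
  apply locally_2d_forall; intros s t H1 H2; simpl in H1, H2.
  set (m := Rmax (Rabs (s - x)) (Rabs (t - y))) in *.
  assert (Hm : 0 <= m)
    by (eapply Rle_trans; [apply Rabs_pos|apply (Rmax_l (Rabs (s - x)))]).
  set (A := U s t - U x y - (u1 * (s - x) + u2 * (t - y))) in *.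
  set (B := V s t - V x y - (v1 * (s - x) + v2 * (t - y))) in *.
  replace (a * U s t + b * V s t - (a * U x y + b * V x y)
    - ((a * u1 + b * v1) * (s - x) + (a * u2 + b * v2) * (t - y)))
    with (a * A + b * B) by (unfold A, B; ring).
  eapply Rle_trans; [apply Rabs_triang|]; rewrite !Rabs_mult.
  apply Rle_trans with (Rabs a * (eps / k * m) + Rabs b * (eps / k * m)).
  { apply Rplus_le_compat; apply Rmult_le_compat_l; auto using Rabs_pos. }
  apply Rle_trans with (k * (eps / k * m)); [|right; field; lra].
  rewrite <- Rmult_plus_distr_r; apply Rmult_le_compat_r.
  - apply Rmult_le_pos; lra.
  - unfold k; lra.
Qed.

Lemma cauchy_riemann_cderiv (F : C -> C) (x y u1 u2 v1 v2 : R) :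
  differentiable_pt_lim (fun s t => Re (F (s, t))) x y u1 u2 ->
  differentiable_pt_lim (fun s t => Im (F (s, t))) x y v1 v2 ->
  v2 = u1 -> v1 = - u2 -> cderiv F (x, y) (u1, v1).
Proof.
  intros HU HV -> ->; apply cderivP; intros e He.
  assert (He2 : 0 < e / 2) by lra.
  destruct (HU (mkposreal _ He2)) as [d1 H1].
  destruct (HV (mkposreal _ He2)) as [d2 H2].
  simpl in H1, H2.
  exists (Rmin d1 d2); split; [apply Rmin_glb_lt; apply cond_pos|].
  intros [s t] Hw.
  assert (Hx : Rabs (s - x) <= Cmod ((s, t) - (x, y)))
    by apply (re_le_Cmod ((s, t) - (x, y))).
  assert (Hy : Rabs (t - y) <= Cmod ((s, t) - (x, y)))
    by apply (im_le_Cmod ((s, t) - (x, y))).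
  pose proof (Rmin_l d1 d2); pose proof (Rmin_r d1 d2).
  specialize (H1 s t ltac:(lra) ltac:(lra)).
  specialize (H2 s t ltac:(lra) ltac:(lra)).
  set (m := Cmod ((s, t) - (x, y))) in *.
  assert (Hm : e / 2 * Rmax (Rabs (s - x)) (Rabs (t - y)) <= e / 2 * m).
  { apply Rmult_le_compat_l; [lra|]; now apply Rmax_lub. }
  eapply Rle_trans; [apply Cmod_le_Re_Im|].
  replace (e * m) with (e / 2 * m + e / 2 * m) by field.
  apply Rplus_le_compat.
  - eapply Rle_trans; [right|eapply Rle_trans; [exact H1|exact Hm]].
    f_equal; unfold Re, Im; simpl; ring.
  - eapply Rle_trans; [right|eapply Rle_trans; [exact H2|exact Hm]].
    f_equal; unfold Re, Im; simpl; ring.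
Qed.

Lemma d_z_coords (F : C -> C) (z : C) :
  d_z F z = ((Re (partial_x F z) + Im (partial_y F z)) / 2,
             (Im (partial_x F z) - Re (partial_y F z)) / 2).
Proof. apply C_ext; unfold d_z, Re, Im; simpl; field. Qed.

Lemma d_zbar_coords (F : C -> C) (z : C) :
  d_zbar F z = ((Re (partial_x F z) - Im (partial_y F z)) / 2,
                (Im (partial_x F z) + Re (partial_y F z)) / 2).
Proof. apply C_ext; unfold d_zbar, Re, Im; simpl; field. Qed.

Lemma ex_diff_n_2_mixed (A : C -> Prop) (W : R -> R -> R) (x y : R) :
  Copen A -> A (x, y) -> (forall u v, A (u, v) -> ex_diff_n W 2 u v) ->
  Derive (fun s => Derive (fun t => W s t) y) x
  = Derive (fun t => Derive (fun s => W s t) x) y.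
Proof.
  intros HA Hxy HW; apply Schwarz.
  - apply Copen_locally_2d with A; auto; intros u v Huv.
    destruct (HW u v Huv) as (_ & H1 & H2 & (_ & _ & H3 & _) & (_ & H4 & _)).
    auto.
  - now destruct (HW x y Hxy) as (_ & _ & _ & _ & (_ & _ & _ & (H & _) & _)).
  - now destruct (HW x y Hxy) as (_ & _ & _ & (_ & _ & _ & _ & (H & _)) & _).
Qed.

(** Once mixed derivatives are exchanged, 4 f_{z zbar} = 0 reads as the Laplace equations for both
    components of f. These are the Cauchy-Riemann equations of f_z, and equally of the conjugate of
    f_zbar; C^2 supplies the real differentiability. *)
Lemma harmonic_d_z_cderiv (A : C -> Prop) (f : C -> C) (z : C) :
  Copen A -> harmonic_mapping_on A f -> A z ->
  (exists l, cderiv (d_z f) z l) /\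
  (exists l, cderiv (fun w => Cconj (d_zbar f w)) z l).
Proof.
  intros HA [HC2 Hh] Hz; destruct z as [x y].
  set (u := fun s t : R => Re (f (s, t))).
  set (v := fun s t : R => Im (f (s, t))).
  assert (Hu : forall s t, A (s, t) -> ex_diff_n u 2 s t)
    by (intros s t H; apply (HC2 _ H)).
  assert (Hv : forall s t, A (s, t) -> ex_diff_n v 2 s t)
    by (intros s t H; apply (HC2 _ H)).
  pose proof (ex_diff_n_2_mixed A u x y HA Hz Hu) as Mu.
  pose proof (ex_diff_n_2_mixed A v x y HA Hz Hv) as Mv.
  assert (Dx : forall W, (forall s t, A (s, t) -> ex_diff_n W 2 s t) ->
    differentiable_pt_lim (fun s t => Derive (fun r => W r t) s) x y
      (Derive (fun s => Derive (fun r => W r y) s) x)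
      (Derive (fun t => Derive (fun r => W r t) x) y)).
  { intros W HW.
    apply (ex_diff_n_1_differentiable A
      (fun s t => Derive (fun r => W r t) s)); auto.
    intros s t Hst; now destruct (HW s t Hst) as (_ & _ & _ & H & _). }
  assert (Dy : forall W, (forall s t, A (s, t) -> ex_diff_n W 2 s t) ->
    differentiable_pt_lim (fun s t => Derive (fun r => W s r) t) x y
      (Derive (fun s => Derive (fun r => W s r) y) x)
      (Derive (fun t => Derive (fun r => W x r) t) y)).
  { intros W HW.
    apply (ex_diff_n_1_differentiable A
      (fun s t => Derive (fun r => W s r) t)); auto.
    intros s t Hst; now destruct (HW s t Hst) as (_ & _ & _ & _ & H). }
  pose proof (Dx u Hu) as Dux; pose proof (Dy u Hu) as Duy.
  pose proof (Dx v Hv) as Dvx; pose proof (Dy v Hv) as Dvy.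
  clear Dx Dy.
  set (uxx := Derive (fun s => Derive (fun r => u r y) s) x) in *.
  set (uxy := Derive (fun t => Derive (fun r => u r t) x) y) in *.
  set (uyy := Derive (fun t => Derive (fun r => u x r) t) y) in *.
  set (vxx := Derive (fun s => Derive (fun r => v r y) s) x) in *.
  set (vxy := Derive (fun t => Derive (fun r => v r t) x) y) in *.
  set (vyy := Derive (fun t => Derive (fun r => v x r) t) y) in *.
  rewrite Mu in Duy; rewrite Mv in Dvy.
  assert (P1 : differentiable_pt_lim (fun s t => Re (d_z f (s, t))) x y
    (/ 2 * uxx + / 2 * vxy) (/ 2 * uxy + / 2 * vyy)).
  { apply differentiable_pt_lim_ext with (fun s t =>
      / 2 * Derive (fun r => u r t) s + / 2 * Derive (fun r => v s r) t).
    - apply locally_2d_forall; intros s t; rewrite d_z_coords.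
      unfold partial_x, partial_y, u, v, Re, Im; simpl; field.
    - now apply differentiable_pt_lim_comb. }
  assert (P2 : differentiable_pt_lim (fun s t => Im (d_z f (s, t))) x y
    (/ 2 * vxx + - / 2 * uxy) (/ 2 * vxy + - / 2 * uyy)).
  { apply differentiable_pt_lim_ext with (fun s t =>
      / 2 * Derive (fun r => v r t) s + - / 2 * Derive (fun r => u s r) t).
    - apply locally_2d_forall; intros s t; rewrite d_z_coords.
      unfold partial_x, partial_y, u, v, Re, Im; simpl; field.
    - now apply differentiable_pt_lim_comb. }
  assert (Q1 : differentiable_pt_lim
    (fun s t => Re (Cconj (d_zbar f (s, t)))) x y
    (/ 2 * uxx + - / 2 * vxy) (/ 2 * uxy + - / 2 * vyy)).
  { apply differentiable_pt_lim_ext with (fun s t =>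
      / 2 * Derive (fun r => u r t) s + - / 2 * Derive (fun r => v s r) t).
    - apply locally_2d_forall; intros s t; rewrite d_zbar_coords.
      unfold partial_x, partial_y, u, v, Re, Im, Cconj; simpl; field.
    - now apply differentiable_pt_lim_comb. }
  assert (Q2 : differentiable_pt_lim
    (fun s t => Im (Cconj (d_zbar f (s, t)))) x y
    (- / 2 * vxx + - / 2 * uxy) (- / 2 * vxy + - / 2 * uyy)).
  { apply differentiable_pt_lim_ext with (fun s t =>
      - / 2 * Derive (fun r => v r t) s + - / 2 * Derive (fun r => u s r) t).
    - apply locally_2d_forall; intros s t; rewrite d_zbar_coords.
      unfold partial_x, partial_y, u, v, Re, Im, Cconj; simpl; field.
    - now apply differentiable_pt_lim_comb. }
  assert (Hlap : uxx + uyy = 0 /\ vxx + vyy = 0).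
  { specialize (Hh _ Hz); rewrite d_zbar_coords in Hh.
    destruct (differentiable_pt_lim_unique _ _ _ _ _ P1) as [R1 R2].
    (* [partial_x] and [partial_y] are values of the total operator [Derive]; uniqueness of the
       differential identifies them with the computed coefficients. *)
    destruct (differentiable_pt_lim_unique _ _ _ _ _ P2) as [R3 R4].
    assert (Hpx : partial_x (d_z f) (x, y)
      = (/ 2 * uxx + / 2 * vxy, / 2 * vxx + - / 2 * uxy))
      by exact (f_equal2 pair R1 R3).
    assert (Hpy : partial_y (d_z f) (x, y)
      = (/ 2 * uxy + / 2 * vyy, / 2 * vxy + - / 2 * uyy))
      by exact (f_equal2 pair R2 R4).
    rewrite Hpx, Hpy in Hh.
    pose proof (f_equal Re Hh) as E1; pose proof (f_equal Im Hh) as E2.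
    unfold Re, Im in E1, E2; simpl in E1, E2; lra. }
  split; eexists.
  - apply cauchy_riemann_cderiv with (1 := P1) (2 := P2); lra.
  - apply (cauchy_riemann_cderiv (fun w => Cconj (d_zbar f w)))
      with (1 := Q1) (2 := Q2); lra.
Qed.

(** This ties the derivatives of the given h and g, known only to exist, to the Wirtinger
    derivatives of f, whose own differentiability comes from C^2. *)
Lemma wirtinger_sum (f h g : C -> C) (A : C -> Prop) (z a b : C) :
  Copen A -> A z -> (forall w, A w -> f w = (h w + Cconj (g w))%C) ->
  cderiv h z a -> cderiv g z b -> d_z f z = a /\ d_zbar f z = Cconj b.
Proof.
  intros HA Hz Hf Ha Hb.
  destruct (HA z Hz) as (d & Hd & Hin).
  assert (Ex : (z = (0, Im z) + RtoC (Re z) * 1)%C) by C_ring.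
  assert (Ey : (z = (Re z, 0) + RtoC (Im z) * Ci)%C) by C_ring.
  assert (Lx : locally (Re z) (fun s : R =>
    f (s, Im z) = (h ((0, Im z) + RtoC s * 1) + Cconj (g ((0, Im z) + RtoC s * 1)))%C)).
  { exists (mkposreal d Hd).
    change (forall s : R, Rabs (s - Re z) < d ->
      f (s, Im z) = (h ((0, Im z) + RtoC s * 1)
                     + Cconj (g ((0, Im z) + RtoC s * 1)))%C); intros s Hs.
    replace ((0, Im z) + RtoC s * 1)%C with ((s, Im z) : C) by C_ring.
    apply Hf, Hin.
    replace ((s, Im z) - z)%C with (RtoC (s - Re z)) by C_ring.
    rewrite Cmod_R; exact Hs. }
  assert (Ly : locally (Im z) (fun s : R =>
    f (Re z, s) = (h ((Re z, 0) + RtoC s * Ci) + Cconj (g ((Re z, 0) + RtoC s * Ci)))%C)).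
  { exists (mkposreal d Hd).
    change (forall s : R, Rabs (s - Im z) < d ->
      f (Re z, s) = (h ((Re z, 0) + RtoC s * Ci)
                     + Cconj (g ((Re z, 0) + RtoC s * Ci)))%C); intros s Hs.
    replace ((Re z, 0) + RtoC s * Ci)%C with ((Re z, s) : C) by C_ring.
    apply Hf, Hin.
    replace ((Re z, s) - z)%C with (Ci * RtoC (s - Im z))%C by C_ring.
    rewrite Cmod_mult, Cmod_Ci, Cmod_R, Rmult_1_l; exact Hs. }
  assert (Px : partial_x f z = (a + Cconj b)%C).
  { rewrite Ex in Ha, Hb.
    apply C_ext; apply is_derive_unique.
    - eapply is_derive_ext_loc;
        [apply (filter_imp _ _ (fun s E => eq_sym (f_equal Re E)) Lx)|].
      evar_last.
      + apply @is_derive_plus;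
          [apply (is_derive_slice_Re _ _ _ _ _ Ha)
          |apply (is_derive_slice_Re _ _ _ _ _ Hb)].
      + unfold plus, Re, Im, Cconj; simpl; ring.
    - eapply is_derive_ext_loc;
        [apply (filter_imp _ _ (fun s E => eq_sym (f_equal Im E)) Lx)|].
      evar_last.
      + apply @is_derive_plus;
          [apply (is_derive_slice_Im _ _ _ _ _ Ha)
          |apply @is_derive_opp; apply (is_derive_slice_Im _ _ _ _ _ Hb)].
      + unfold plus, opp, Re, Im, Cconj; simpl; ring. }
  assert (Py : partial_y f z = (Ci * a - Ci * Cconj b)%C).
  { rewrite Ey in Ha, Hb.
    apply C_ext; apply is_derive_unique.
    - eapply is_derive_ext_loc;
        [apply (filter_imp _ _ (fun s E => eq_sym (f_equal Re E)) Ly)|].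
      evar_last.
      + apply @is_derive_plus;
          [apply (is_derive_slice_Re _ _ _ _ _ Ha)
          |apply (is_derive_slice_Re _ _ _ _ _ Hb)].
      + unfold plus, Re, Im, Cconj; simpl; ring.
    - eapply is_derive_ext_loc;
        [apply (filter_imp _ _ (fun s E => eq_sym (f_equal Im E)) Ly)|].
      evar_last.
      + apply @is_derive_plus;
          [apply (is_derive_slice_Im _ _ _ _ _ Ha)
          |apply @is_derive_opp; apply (is_derive_slice_Im _ _ _ _ _ Hb)].
      + unfold plus, opp, Re, Im, Cconj; simpl; ring. }
  rewrite d_z_coords, d_zbar_coords, Px, Py.
  split; apply C_ext; unfold Re, Im, Cconj; simpl; field.
Qed.

Lemma harmonic_parts (A : C -> Prop) (f h g : C -> C) : Copen A ->
  analytic_on A h -> analytic_on A g ->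
  (forall z, A z -> f z = (h z + Cconj (g z))%C) -> harmonic_mapping_on A f ->
  exists h1 h2 g1 g2 : C -> C, forall z, A z ->
    cderiv h z (h1 z) /\ cderiv h1 z (h2 z) /\
    cderiv g z (g1 z) /\ cderiv g1 z (g2 z) /\
    d_z f z = h1 z /\ d_zbar f z = Cconj (g1 z).
Proof.
  intros HA Hh Hg Hf Hharm.
  assert (Hdz : forall z, A z -> cderiv h z (d_z f z)
    /\ cderiv g z (Cconj (d_zbar f z))).
  { intros z Hz.
    destruct (ex_derive_cderiv _ _ (Hh z Hz)) as [a Ha].
    destruct (ex_derive_cderiv _ _ (Hg z Hz)) as [b Hb].
    destruct (wirtinger_sum f h g A z a b HA Hz Hf Ha Hb) as [-> ->].
    now rewrite Cconj_conj. }
  assert (H2 : forall z, exists p : C * C, A z ->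
    cderiv (d_z f) z (fst p) /\ cderiv (fun w => Cconj (d_zbar f w)) z (snd p)).
  { intros z; destruct (classic (A z)) as [Hz|Hz].
    - destruct (harmonic_d_z_cderiv A f z HA Hharm Hz) as [[a Ha] [b Hb]].
      now exists (a, b).
    - exists (RtoC 0, RtoC 0); tauto. }
  apply choice in H2; destruct H2 as [p Hp].
  exists (d_z f), (fun z => fst (p z)), (fun z => Cconj (d_zbar f z)),
    (fun z => snd (p z)).
  intros z Hz; destruct (Hdz z Hz), (Hp z Hz); rewrite Cconj_conj; auto 10.
Qed.

(** * Open mapping and schlicht discs *)

Lemma open_Copen (U : C -> Prop) : @open C_UniformSpace U <-> Copen U.
Proof.
  split; intros H z Hz.
  - destruct (H z Hz) as [d Hd]; exists d; split; [apply cond_pos|].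
    intros w Hw; apply Hd, C_NormedModule_mixin_compat1; exact Hw.
  - destruct (H z Hz) as (d & Hd & Hw).
    assert (Hd2 : 0 < d / 2) by lra.
    exists (mkposreal _ Hd2); intros w [H1 H2]; apply Hw.
    change (Rabs (Re w - Re z) < d / 2) in H1.
    change (Rabs (Im w - Im z) < d / 2) in H2.
    eapply Rle_lt_trans; [apply Cmod_le_Re_Im|].
    change (Rabs (Re w - Re z) + Rabs (Im w - Im z) < d); lra.
Qed.

Lemma unit_interval_connected (P Q : R -> Prop) :
  (forall t, 0 <= t <= 1 -> P t -> exists d, 0 < d /\
     forall s, 0 <= s <= 1 -> Rabs (s - t) < d -> P s) ->
  (forall t, 0 <= t <= 1 -> Q t -> exists d, 0 < d /\
     forall s, 0 <= s <= 1 -> Rabs (s - t) < d -> Q s) ->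
  (forall t, 0 <= t <= 1 -> P t \/ Q t) -> P 0 -> Q 1 ->
  exists t, 0 <= t <= 1 /\ P t /\ Q t.
Proof.
  intros HP HQ Hcov H0 H1.
  destruct (completeness (fun t => 0 <= t <= 1 /\ P t)) as [s [Hub Hlub]].
  { exists 1; intros t [Ht _]; lra. }
  { exists 0; split; [lra|auto]. }
  assert (Hs : 0 <= s <= 1).
  { split; [apply Hub; split; [lra|auto]|].
    apply Hlub; intros t [Ht _]; lra. }
  destruct (Hcov s Hs) as [Ps|Qs].
  - destruct (HP s Hs Ps) as (d & Hd & H).
    destruct (Rle_lt_or_eq_dec _ _ (proj2 Hs)) as [Hlt| ->].
    + exfalso; set (t := Rmin 1 (s + d / 2)).
      assert (Ht : s < t) by (apply Rmin_glb_lt; lra).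
      pose proof (Rmin_l 1 (s + d / 2)) as L1.
      pose proof (Rmin_r 1 (s + d / 2)) as L2.
      fold t in L1, L2.
      assert (Pt : P t) by (apply H; [lra|]; rewrite Rabs_pos_eq; lra).
      assert (t <= s) by (apply Hub; split; [lra|auto]); lra.
    + exists 1; auto.
  - destruct (HQ s Hs Qs) as (d & Hd & H).
    apply NNPP; intros Hno.
    assert (s <= s - d); [|lra].
    apply Hlub; intros t [Ht Pt].
    assert (t <= s) by (apply Hub; auto).
    apply Rnot_lt_le; intros Hlt; apply Hno; exists t.
    repeat split; try lra; auto.
    apply H; [lra|]; rewrite Rabs_left1; lra.
Qed.

Lemma disk_segment (a z w : C) (r t : R) : 0 <= t <= 1 ->
  disk a r z -> disk a r w -> disk a r (z + RtoC t * (w - z))%C.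
Proof.
  unfold disk; intros Ht Hz Hw.
  replace (z + RtoC t * (w - z) - a)%C
    with (RtoC (1 - t) * (z - a) + RtoC t * (w - a))%C
    by (rewrite RtoC_minus; ring).
  eapply Rle_lt_trans; [apply Cmod_triangle|].
  rewrite !Cmod_mult, !Cmod_R, !Rabs_pos_eq by lra.
  pose proof (Cmod_ge_0 (z - a)); pose proof (Cmod_ge_0 (w - a)).
  destruct (Rle_lt_or_eq_dec _ _ (proj1 Ht)) as [H1|<-]; nra.
Qed.

Lemma disk_connected (a : C) (r : R) : connected_set (disk a r).
Proof.
  intros U V HU HV Hcov (p & Dp & Up) (q & Dq & Vq).
  apply open_Copen in HU; apply open_Copen in HV.
  set (gam := fun t : R => (p + RtoC t * (q - p))%C).
  assert (Hop : forall W, Copen W -> forall t, 0 <= t <= 1 -> W (gam t) ->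
    exists d, 0 < d /\
      forall s, 0 <= s <= 1 -> Rabs (s - t) < d -> W (gam s)).
  { intros W HW t Ht Wt; destruct (HW _ Wt) as (d & Hd & H).
    pose proof (Cmod_ge_0 (q - p)).
    exists (d / (Cmod (q - p) + 1)); split; [apply Rdiv_lt_0_compat; lra|].
    intros s Hs Hst; apply H; unfold gam.
    replace (p + RtoC s * (q - p) - (p + RtoC t * (q - p)))%C
      with (RtoC (s - t) * (q - p))%C by (rewrite RtoC_minus; ring).
    rewrite Cmod_mult, Cmod_R.
    apply Rlt_div_r in Hst; [|lra].
    pose proof (Rabs_pos (s - t)); nra. }
  destruct (unit_interval_connected (fun t => U (gam t)) (fun t => V (gam t)))
    as (t & Ht & Ut & Vt); auto.
  - intros t Ht; apply Hcov; now apply disk_segment.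
  - unfold gam; now replace (p + RtoC 0 * (q - p))%C with p by ring.
  - unfold gam; now replace (p + RtoC 1 * (q - p))%C with q by ring.
  - exists (gam t); repeat split; auto; now apply disk_segment.
Qed.

(** Real differentiability with differential u -> a u + conj (b u): a is f_z and b is the conjugate
    of f_zbar. The differential stretches by at least |a| - |b|, so |b| < |a| makes it
    invertible. *)
Definition hdiff (f : C -> C) (z a b : C) : Prop :=
  forall e, 0 < e -> exists d, 0 < d /\ forall w, Cmod (w - z) < d ->
    Cmod (f w - f z - (a * (w - z) + Cconj (b * (w - z))))
    <= e * Cmod (w - z).

Lemma hdiff_sum (A : C -> Prop) (f h g : C -> C) (z a b : C) :
  Copen A -> A z -> (forall w, A w -> f w = (h w + Cconj (g w))%C) ->
  cderiv h z a -> cderiv g z b -> hdiff f z a b.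
Proof.
  intros HA Hz Hf Ha Hb e He.
  rewrite cderivP in Ha, Hb.
  destruct (HA z Hz) as (d0 & Hd0 & Hin).
  destruct (Ha (e / 2)) as (d1 & Hd1 & H1); [lra|].
  destruct (Hb (e / 2)) as (d2 & Hd2 & H2); [lra|].
  exists (Rmin d0 (Rmin d1 d2)); split; [repeat apply Rmin_glb_lt; lra|].
  intros w Hw.
  pose proof (Rmin_l d0 (Rmin d1 d2)); pose proof (Rmin_r d0 (Rmin d1 d2)).
  pose proof (Rmin_l d1 d2); pose proof (Rmin_r d1 d2).
  specialize (H1 w ltac:(lra)); specialize (H2 w ltac:(lra)).
  rewrite !Hf by (auto; apply Hin; lra).
  replace (h w + Cconj (g w) - (h z + Cconj (g z))
           - (a * (w - z) + Cconj (b * (w - z))))%C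
    with ((h w - h z - a * (w - z)) + Cconj (g w - g z - b * (w - z)))%C
    by (rewrite !Cminus_conj; ring).
  eapply Rle_trans; [apply Cmod_triangle|]; rewrite Cmod_conj; lra.
Qed.

Lemma hdiff_ccont f z a b : hdiff f z a b -> ccont f z.
Proof.
  intros Hd e He; destruct (Hd 1) as (d & Hdp & H); [lra|].
  set (k := Cmod a + Cmod b + 1).
  assert (Hk : 0 < k)
    by (unfold k; pose proof (Cmod_ge_0 a); pose proof (Cmod_ge_0 b); lra).
  exists (Rmin d (e / k)); split.
  { apply Rmin_glb_lt; auto; now apply Rdiv_lt_0_compat. }
  intros w Hw.
  pose proof (Rmin_l d (e / k)); pose proof (Rmin_r d (e / k)).
  specialize (H w ltac:(lra)).
  assert (Hwk : Cmod (w - z) * k < e) by (apply Rlt_div_r; lra).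
  pose proof (Cmod_le_diff (f w - f z)
    (a * (w - z) + Cconj (b * (w - z)))) as T1.
  pose proof (Cmod_triangle (a * (w - z)) (Cconj (b * (w - z)))) as T2.
  rewrite Cmod_conj, !Cmod_mult in T2.
  unfold k in Hwk; lra.
Qed.

Lemma Cmod_linear_lower (a b u : C) :
  (Cmod a - Cmod b) * Cmod u <= Cmod (a * u + Cconj (b * u)).
Proof.
  pose proof (Cmod_le_sum (a * u) (Cconj (b * u))) as H.
  rewrite Cmod_conj, !Cmod_mult in H; lra.
Qed.

(** A Newton step: moving z by tau u, where the differential sends u to -(f(z) - w), changes the
    distance to w by the factor 1 - tau up to an error, so a positive distance cannot be minimal. *)
Lemma local_min_value (f : C -> C) (z w a b : C) (s : R) : 0 < s ->
  hdiff f z a b -> Cmod b < Cmod a ->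
  (forall t, Cmod (t - z) < s -> Cmod (f z - w) <= Cmod (f t - w)) ->
  f z = w.
Proof.
  intros Hs Hd Hab Hmin; apply NNPP; intros Hne.
  set (e := (f z - w)%C).
  assert (He : 0 < Cmod e) by now apply Cmod_gt_0, Cminus_neq_0.
  set (J := Cmod a ^ 2 - Cmod b ^ 2).
  assert (HJ : 0 < J) by (pose proof (Cmod_ge_0 b); unfold J; nra).
  (* u solves [a u + conj (b u) = - e] *)
  set (u := (RtoC (- / J) * (Cconj a * e - Cconj b * Cconj e))%C).
  assert (Hu : (a * u + Cconj (b * u) = - e)%C).
  { assert (HJe : J = fst a ^ 2 + snd a ^ 2 - (fst b ^ 2 + snd b ^ 2))
      by (unfold J; rewrite !Cmod2_alt; reflexivity).
    unfold u; clearbody e J; destruct a as [a1 a2], b as [b1 b2], e as [e1 e2].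
    simpl in HJe.
    apply C_ext; unfold Re, Im, Cconj; simpl; field_simplify; try lra;
      rewrite HJe in *; field; lra. }
  pose proof (Cmod_ge_0 u) as Hu0.
  (* With this tolerance the error at z + tau u is at most tau |e| / 2, half of what the step
     gains. *)
  destruct (Hd (Cmod e / (2 * (Cmod u + 1)))) as (d & Hdp & H).
  { apply Rdiv_lt_0_compat; lra. }
  set (tau := Rmin 1 (Rmin s d / (2 * (Cmod u + 1)))).
  assert (Hsd : 0 < Rmin s d) by (apply Rmin_glb_lt; lra).
  assert (Ht : 0 < tau)
    by (apply Rmin_glb_lt; [lra|apply Rdiv_lt_0_compat; lra]).
  assert (Ht1 : tau <= 1) by apply Rmin_l.
  assert (Ht2 : tau * (2 * (Cmod u + 1)) <= Rmin s d)
    by (apply Rle_div_r; [lra|apply Rmin_r]).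
  pose proof (Rmin_l s d); pose proof (Rmin_r s d).
  set (t := (z + RtoC tau * u)%C).
  assert (Etz : (t - z = RtoC tau * u)%C) by (unfold t; ring).
  assert (Htz : Cmod (t - z) = tau * Cmod u)
    by (rewrite Etz, Cmod_mult, Cmod_R, Rabs_pos_eq; lra).
  specialize (H t); specialize (Hmin t); rewrite Htz in H, Hmin.
  specialize (H ltac:(nra)); specialize (Hmin ltac:(nra)).
  rewrite Etz in H.
  replace (a * (RtoC tau * u) + Cconj (b * (RtoC tau * u)))%C
    with (- (RtoC tau * e))%C in H.
  2:{ transitivity (RtoC tau * (- e))%C; [ring|]; rewrite <- Hu.
      rewrite !Cmult_conj; replace (Cconj (RtoC tau)) with (RtoC tau)
        by (unfold Cconj; C_ring); ring. }
  pose proof (Cmod_triangle (f t - f z - - (RtoC tau * e))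
    (RtoC (1 - tau) * e)) as T.
  replace (f t - f z - - (RtoC tau * e) + RtoC (1 - tau) * e)%C
    with (f t - w)%C in T by (unfold e; rewrite RtoC_minus; ring).
  rewrite Cmod_mult, Cmod_R, Rabs_pos_eq in T by lra.
  assert (Hsmall : Cmod e / (2 * (Cmod u + 1)) * (tau * Cmod u)
                   <= tau * Cmod e / 2).
  { replace (Cmod e / (2 * (Cmod u + 1)) * (tau * Cmod u))
      with (tau * Cmod e / 2 * (Cmod u / (Cmod u + 1))) by (field; lra).
    rewrite <- (Rmult_1_r (tau * Cmod e / 2)) at 2.
    apply Rmult_le_compat_l; [nra|].
    apply Rle_div_l; lra. }
  fold e in Hmin; nra.
Qed.

Lemma ccont_dist_lsc (f : C -> C) (w c : C) (r : R) :
  (forall z, Cmod (z - c) <= r -> ccont f z) ->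
  forall z, Cmod (z - c) <= r -> forall e, 0 < e -> exists d, 0 < d /\
    forall t, Cmod (t - c) <= r -> Cmod (t - z) < d ->
      Cmod (f z - w) - e < Cmod (f t - w).
Proof.
  intros Hc z Hz e He; destruct (Hc z Hz e He) as (d & Hd & H).
  exists d; split; auto; intros t _ Ht; specialize (H t Ht).
  rewrite Cmod_minus_sym in H.
  pose proof (Cmod_minus_triangle (f z) (f t) w); lra.
Qed.

(** For w near f(z0), |f - w| attains its minimum over a small closed disc in the interior, because
    f stays away from f(z0) on the circle; an interior minimum has value 0. *)
Lemma open_mapping (A W : C -> Prop) (f : C -> C) :
  (forall z, A z -> exists a b, hdiff f z a b /\ Cmod b < Cmod a) ->
  Copen W -> (forall z, W z -> A z) ->
  Copen (fun w => exists z, W z /\ f z = w).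
Proof.
  intros Hd HW HWA w0 (z0 & Wz0 & <-).
  destruct (HW z0 Wz0) as (d & Hdp & Hin).
  destruct (Hd z0 (HWA z0 Wz0)) as (a & b & Hab & Hlt).
  set (k := Cmod a - Cmod b).
  assert (Hk : 0 < k) by (unfold k; lra).
  destruct (Hab (k / 2)) as (d' & Hd'p & H); [lra|].
  set (s := Rmin d d' / 2).
  assert (Hs : 0 < s < d /\ s < d').
  { assert (0 < Rmin d d') by (apply Rmin_glb_lt; lra).
    pose proof (Rmin_l d d'); pose proof (Rmin_r d d'); unfold s; lra. }
  clearbody s.
  assert (Hcirc : forall z, Cmod (z - z0) = s -> k / 2 * s <= Cmod (f z - f z0)).
  { intros z Hz; specialize (H z ltac:(lra)); rewrite Hz in H.
    pose proof (Cmod_linear_lower a b (z - z0)) as T1; rewrite Hz in T1.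
    fold k in T1.
    pose proof (Cmod_le_diff (a * (z - z0) + Cconj (b * (z - z0)))
      (f z - f z0)) as T2.
    rewrite (Cmod_minus_sym _ (f z - f z0)) in T2; lra. }
  (* On the circle |f - f(z0)| >= k s / 2, so for these w the distance to w exceeds k s / 4 there
     and is smaller at z0. *)
  exists (k / 4 * s); split; [nra|]; intros w Hw.
  destruct (lsc_attains_min (fun z => Cmod (f z - w)) z0 s) as (z1 & Hz1 & Hm);
    [lra| |].
  { apply ccont_dist_lsc; intros z Hz.
    destruct (Hd z) as (a' & b' & Hab' & _); [apply HWA, Hin; lra|].
    exact (hdiff_ccont _ _ _ _ Hab'). }
  exists z1; split; [apply Hin; lra|].
  assert (Hz1s : Cmod (z1 - z0) < s).
  { destruct (Rle_lt_or_eq_dec _ _ Hz1) as [|E]; auto; exfalso.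
    specialize (Hm z0); rewrite Cmod_minus_self in Hm; specialize (Hm ltac:(lra)).
    specialize (Hcirc z1 E).
    pose proof (Cmod_minus_triangle (f z1) w (f z0)) as T.
    rewrite (Cmod_minus_sym (f z0) w) in Hm; lra. }
  destruct (Hd z1) as (a' & b' & Hab' & Hlt'); [apply HWA, Hin; lra|].
  apply (local_min_value f z1 w a' b' (s - Cmod (z1 - z0))); auto; [lra|].
  intros t Ht; apply Hm.
  pose proof (Cmod_minus_triangle t z1 z0); lra.
Qed.

Lemma closed_disk_image_closed (f : C -> C) (c : C) (r : R) : 0 <= r ->
  (forall z, Cmod (z - c) <= r -> ccont f z) ->
  Copen (fun w => ~ exists z, Cmod (z - c) <= r /\ f z = w).
Proof.
  intros Hr Hc w Hw.
  destruct (lsc_attains_min (fun z => Cmod (f z - w)) c r) as (z0 & Hz0 & Hm);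
    auto.
  { now apply ccont_dist_lsc. }
  assert (Hp : 0 < Cmod (f z0 - w)).
  { apply Cmod_gt_0, Cminus_neq_0; intros E; apply Hw; now exists z0. }
  exists (Cmod (f z0 - w)); split; auto; intros w' Hw' (z & Hz & E).
  specialize (Hm z Hz); rewrite E in Hm; lra.
Qed.

(** Omega is the part of the disc that f maps into the target disc. That nothing in the target is
    missed, and that Omega is connected, both follow from the connectedness of the target. *)
Lemma schlicht_disk_of_boundary (A : C -> Prop) (f : C -> C) (c : C) (r rho : R) :
  0 < r -> 0 < rho -> (forall z, Cmod (z - c) <= r -> A z) ->
  (forall z, A z -> exists a b, hdiff f z a b /\ Cmod b < Cmod a) ->
  univalent_on (disk c r) f ->
  (forall z, Cmod (z - c) = r -> rho <= Cmod (f z - f c)) ->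
  contains_schlicht_disk (disk c r) f (f c) rho.
Proof.
  intros Hr Hrho HA Hd Hinj Hbd.
  assert (Hcont : forall z, A z -> ccont f z).
  { intros z Hz; destruct (Hd z Hz) as (a & b & H & _).
    exact (hdiff_ccont _ _ _ _ H). }
  assert (HdA : forall z, disk c r z -> A z)
    by (intros z Hz; apply HA; unfold disk in Hz; lra).
  assert (Hc : disk c r c) by (unfold disk; now rewrite Cmod_minus_self).
  assert (Hfc : disk (f c) rho (f c)) by (unfold disk; now rewrite Cmod_minus_self).
  set (Om := fun z => disk c r z /\ disk (f c) rho (f z)).
  assert (HOm : Copen Om).
  { intros z [H1 H2].
    destruct (disk_Copen c r z H1) as (d1 & Hd1 & K1).
    destruct (disk_Copen _ _ _ H2) as (d2 & Hd2 & K2).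
    destruct (Hcont z (HdA z H1) d2 Hd2) as (d3 & Hd3 & K3).
    exists (Rmin d1 d3); split; [now apply Rmin_glb_lt|]; intros w Hw; split.
    - apply K1; eapply Rlt_le_trans; [apply Hw|apply Rmin_l].
    - apply K2, K3; eapply Rlt_le_trans; [apply Hw|apply Rmin_r]. }
  assert (Hopen : forall W, Copen W ->
    Copen (fun w => exists z, (Om z /\ W z) /\ f z = w)).
  { intros W HW; apply (open_mapping A); auto.
    - intros z [Oz Wz]; destruct (HOm z Oz) as (d1 & Hd1 & K1).
      destruct (HW z Wz) as (d2 & Hd2 & K2).
      exists (Rmin d1 d2); split; [now apply Rmin_glb_lt|]; intros w Hw; split.
      + apply K1; eapply Rlt_le_trans; [apply Hw|apply Rmin_l].
      + apply K2; eapply Rlt_le_trans; [apply Hw|apply Rmin_r].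
    - intros z [[Hz _] _]; auto. }
  assert (Hsurj : forall w, disk (f c) rho w -> exists z, Om z /\ f z = w).
  (* Circle points have images at distance at least rho, so a target value taken on the closed disc
     is taken inside. Hence the two open sets below cover the target and are disjoint. *)
  { assert (Hlift : forall w, disk (f c) rho w ->
      (exists z, Cmod (z - c) <= r /\ f z = w) -> exists z, disk c r z /\ f z = w).
    { intros w Hw (z & Hz & E); exists z; split; auto.
      destruct (Rle_lt_or_eq_dec _ _ Hz) as [|Ez]; auto; exfalso.
      specialize (Hbd z Ez); unfold disk in Hw; rewrite E in Hbd; lra. }
    intros w Hw; apply NNPP; intros Hno.
    destruct (disk_connected (f c) rho
      (fun w => exists z, disk c r z /\ f z = w)
      (fun w => ~ exists z, Cmod (z - c) <= r /\ f z = w)) as (v & _ & V1 & V2).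
    - apply open_Copen, (open_mapping A); auto using disk_Copen.
    - apply open_Copen, closed_disk_image_closed; [lra|auto].
    - intros v Hv.
      destruct (classic (exists z, Cmod (z - c) <= r /\ f z = v)); auto.
    - exists (f c); split; auto; now exists c.
    - exists w; split; auto; intros Hex; apply Hno.
      destruct (Hlift w Hw Hex) as (z & Hz & E); exists z.
      split; [split; auto; now rewrite E|auto].
    - apply V2; destruct V1 as (z & Hz & E); exists z; split; auto.
      unfold disk in Hz; lra. }
  exists Om; split; [|split; [|split]].
  - split; [now exists c|split; [now apply open_Copen|]].
    intros U V HU HV Hcov (p & Op & Up) (q & Oq & Vq).
    apply open_Copen in HU; apply open_Copen in HV.
    (* f is open and injective on Omega: the two pieces are pushed forward to open sets covering the
       target disc, and a common value comes from a common point. *)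
    destruct (disk_connected (f c) rho
      (fun w => exists z, (Om z /\ U z) /\ f z = w)
      (fun w => exists z, (Om z /\ V z) /\ f z = w))
      as (w & _ & (z & [Oz Uz] & E) & (z' & [Oz' Vz'] & E')).
    + apply open_Copen; auto.
    + apply open_Copen; auto.
    + intros w Hw; destruct (Hsurj w Hw) as (z & Oz & E).
      destruct (Hcov z Oz); [left|right]; exists z; auto.
    + exists (f p); split; [apply Op|now exists p].
    + exists (f q); split; [apply Oq|now exists q].
    + exists z; split; auto; split; auto.
      replace z with z'; auto.
      apply Hinj; [apply Oz'|apply Oz|congruence].
  - intros z [Hz _]; exact Hz.
  - intros z w [Hz _] [Hw _]; now apply Hinj.
  - intros w; split; [apply Hsurj|].
    intros (z & [_ Hz] & <-); exact Hz.
Qed.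

(** * Landau's theorem for harmonic mappings with bounded dilatation *)

(** Turn B until c B points opposite to A: then |A + c B| is ||A| - |B||, the least value compatible
    with the two moduli. *)
Lemma exists_rotation (A B : C) :
  exists c, Cmod c = 1 /\ Cmod (A + c * B) <= Cmod (A + Cconj B).
Proof.
  destruct (classic (A = 0)) as [->|HA].
  { exists (RtoC 1); split; [apply Cmod_1|].
    rewrite !Cplus_0_l, Cmult_1_l, Cmod_conj; lra. }
  destruct (classic (B = 0)) as [->|HB].
  { exists (RtoC 1); split; [apply Cmod_1|].
    replace (Cconj 0) with (RtoC 0) by (unfold Cconj; C_ring).
    rewrite Cmult_1_l; lra. }
  pose proof (proj1 (Cmod_gt_0 _) HA) as HA'.
  pose proof (proj1 (Cmod_gt_0 _) HB) as HB'.
  exists (RtoC (- (Cmod B / Cmod A)) * (A * / B))%C; split.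
  - rewrite !Cmod_mult, Cmod_inv, Cmod_R, Rabs_Ropp, Rabs_pos_eq by
      (auto; apply Rdiv_le_0_compat; lra).
    field; lra.
  - replace (A + RtoC (- (Cmod B / Cmod A)) * (A * / B) * B)%C
      with (RtoC (1 - Cmod B / Cmod A) * A)%C.
    + rewrite Cmod_mult, Cmod_R.
      rewrite <- (Rabs_pos_eq (Cmod A)) at 2 by lra.
      rewrite <- Rabs_mult.
      replace ((1 - Cmod B / Cmod A) * Cmod A) with (Cmod A - Cmod B)
        by (field; lra).
      pose proof (Cmod_le_sum A (Cconj B)) as H1.
      pose proof (Cmod_le_sum (Cconj B) A) as H2.
      rewrite Cmod_conj in H1, H2; rewrite (Cplus_comm _ A) in H2.
      apply Rabs_le; lra.
    + rewrite RtoC_minus, RtoC_opp; field; auto.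
Qed.

(** The primitive, vanishing at s = 0, of the lower bound L (1 - L t) / (L - t) along a radius, with
    |z| = s r / L and t = s / L. The value s = 1 corresponds to the full radius r / L. *)
Definition landau_radius (r L s : R) : R :=
  r * L * (s + (1 - L ^ 2) * (ln L - ln (L - s / L))).

Lemma is_derive_landau_radius (r L s : R) : 1 < L -> 0 <= s <= 1 ->
  is_derive (landau_radius r L) s
    (r / L * (L * (1 - L * (s / L)) / (L - s / L))).
Proof.
  intros HL Hs.
  assert (Hq : s / L < L) by (apply Rlt_div_l; nra).
  unfold landau_radius; auto_derive; [unfold Rdiv in Hq; repeat split; lra|].
  assert (s < L * L) by nra.
  field; split; lra.
Qed.

Lemma landau_radius_pos (r L : R) : 0 < r -> 1 < L -> 0 < landau_radius r L 1.
Proof.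
  intros Hr HL.
  assert (E0 : landau_radius r L 0 = 0).
  { unfold landau_radius, Rdiv; rewrite Rmult_0_l, Rminus_0_r; ring. }
  destruct (MVT_cor2 (landau_radius r L)
    (fun s => r / L * (L * (1 - L * (s / L)) / (L - s / L))) 0 1)
    as (s & E & Hs); [lra| |].
  { intros s Hs; apply is_derive_Reals; now apply is_derive_landau_radius. }
  rewrite E0, !Rminus_0_r, Rmult_1_r in E; rewrite E.
  assert (s / L < L) by (apply Rlt_div_l; nra).
  replace (L * (s / L)) with s by (field; lra).
  apply Rmult_lt_0_compat; [apply Rdiv_lt_0_compat; lra|].
  apply Rdiv_lt_0_compat; nra.
Qed.

Section Landau.

Variables (h h1 h2 g g1 g2 : C -> C) (r L : R).
Hypothesis Hr : 0 < r.
Hypothesis HL : 1 < L.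
Hypothesis Hh : forall z, Cmod z < r -> cderiv h z (h1 z) /\ cderiv h1 z (h2 z).
Hypothesis Hg : forall z, Cmod z < r -> cderiv g z (g1 z) /\ cderiv g1 z (g2 z).
Hypothesis Hbound : forall z, Cmod z < r -> Cmod (h1 z) + Cmod (g1 z) < L.
Hypothesis Hcentre : Cmod (h1 0) - Cmod (g1 0) = 1.

Lemma rotated_derivative (c : C) (z : C) : Cmod z < r ->
  cderiv (fun w => h w + c * g w)%C z (h1 z + c * g1 z)%C.
Proof.
  intros Hz; apply cderiv_plus; [now apply Hh|]; now apply cderiv_scal, Hg.
Qed.

Lemma rotated_centre (c : C) : Cmod c = 1 -> 1 <= Cmod (h1 0 + c * g1 0).
Proof.
  intros Hc; pose proof (Cmod_le_sum (h1 0) (c * g1 0)) as H.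
  rewrite Cmod_mult, Hc in H; lra.
Qed.

Lemma rotated_real_part (c : C) (z : C) : Cmod c = 1 -> Cmod z < r ->
  L * (1 - L * (Cmod z / r)) / (L - Cmod z / r)
  <= Re (Cconj (h1 0 + c * g1 0) * (h1 z + c * g1 z))%C
     / Cmod (h1 0 + c * g1 0).
Proof.
  intros Hc Hz.
  assert (Hlt : forall z, Cmod z < r -> Cmod (h1 z + c * g1 z) < L).
  { intros t Ht; pose proof (Cmod_triangle (h1 t) (c * g1 t)) as T.
    rewrite Cmod_mult, Hc in T; specialize (Hbound t Ht); lra. }
  pose proof (Cmod_ge_0 z).
  apply pick_real_part.
  - split; [apply Rdiv_le_0_compat; lra|apply Rlt_div_l; lra].
  - auto.
  - apply Hlt; rewrite Cmod_0; lra.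
  - now apply rotated_centre.
  - pose proof (schwarz_pick (fun w => h w + c * g w)%C
      (fun w => h1 w + c * g1 w)%C (fun w => h2 w + c * g2 w)%C r L) as SP.
    specialize (SP) with (3 := Hz); cbv beta in SP.
    apply Rmult_le_reg_l with r; [lra|].
    rewrite <- Rmult_assoc.
    eapply Rle_trans; [apply SP|right; field; lra].
    + intros t Ht; split; [now apply rotated_derivative|].
      apply cderiv_plus; [now apply Hh|]; now apply cderiv_scal, Hg.
    + exact Hlt.
Qed.

Lemma rotated_real_part_pos (c : C) (z : C) : Cmod c = 1 -> Cmod z < r / L ->
  0 < Re (Cconj (h1 0 + c * g1 0) * (h1 z + c * g1 z))%C.
Proof.
  intros Hc Hz.
  pose proof (Cmod_ge_0 z) as H0.
  assert (HzL : Cmod z * L < r) by (apply Rlt_div_r; lra).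
  assert (Hzr : Cmod z < r) by nra.
  pose proof (rotated_real_part c z Hc Hzr) as H.
  pose proof (rotated_centre c Hc) as H1.
  assert (Ht : L * (Cmod z / r) < 1).
  { replace (L * (Cmod z / r)) with (Cmod z * L / r) by (field; lra).
    apply Rlt_div_l; lra. }
  assert (Ht1 : Cmod z / r < 1) by (apply Rlt_div_l; lra).
  assert (Hpos : 0 < L * (1 - L * (Cmod z / r)) / (L - Cmod z / r)).
  { apply Rdiv_lt_0_compat; [apply Rmult_lt_0_compat; lra|lra]. }
  assert (Hq : 0 < Re (Cconj (h1 0 + c * g1 0) * (h1 z + c * g1 z))%C
                   / Cmod (h1 0 + c * g1 0)) by lra.
  apply Rlt_div_r in Hq; lra.
Qed.

Lemma landau_univalent (z w : C) : Cmod z < r / L -> Cmod w < r / L ->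
  (h z + Cconj (g z) = h w + Cconj (g w))%C -> z = w.
Proof.
  intros Hz Hw E; apply NNPP; intros Hne.
  destruct (exists_rotation (h z - h w) (g z - g w)) as (c & Hc & Hle).
  replace (h z - h w + Cconj (g z - g w))%C with (RtoC 0) in Hle.
  2:{ rewrite Cminus_conj.
      transitivity ((h z + Cconj (g z)) - (h w + Cconj (g w)))%C; [|ring].
      rewrite E; ring. }
  rewrite Cmod_0 in Hle.
  pose proof (Cmod_ge_0 (h z - h w + c * (g z - g w))) as Hge.
  assert (E0 : (h z - h w + c * (g z - g w) = 0)%C)
    by (apply Cmod_eq_0; lra).
  assert (HrL : r / L < r) by (apply Rlt_div_l; nra).
  assert (Hseg : forall t, 0 <= t <= 1 ->
    Cmod (w + RtoC t * (z - w)) < r / L).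
  { intros t Ht; pose proof (disk_segment 0 w z (r / L) t Ht) as H.
    unfold disk in H.
    replace (w + RtoC t * (z - w))%C
      with (w + RtoC t * (z - w) - 0)%C by ring.
    apply H; [replace (w - 0)%C with w by ring
             |replace (z - 0)%C with z by ring]; auto. }
  (* The weight conj phi(0) / (z - w) cancels the length of the segment: the zero increment of h + c
     g would equal Re (conj phi(0) phi(x)), which is positive. *)
  destruct (C_segment_mean_value (fun w => h w + c * g w)%C
    (fun w => h1 w + c * g1 w)%C w z
    (Cconj (h1 0 + c * g1 0) * / (z - w))%C) as (t & Ht & Em).
  { intros t Ht; apply rotated_derivative; specialize (Hseg t Ht); lra. }
  pose proof (rotated_real_part_pos c _ Hc (Hseg t Ht)) as Hpos.
  set (x := (w + RtoC t * (z - w))%C) in *.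
  replace (Cconj (h1 0 + c * g1 0) * / (z - w) * (h1 x + c * g1 x) * (z - w))%C
    with (Cconj (h1 0 + c * g1 0) * (h1 x + c * g1 x))%C in Em
    by (field; now apply Cminus_neq_0).
  replace (h z + c * g z - (h w + c * g w))%C
    with (h z - h w + c * (g z - g w))%C in Em by ring.
  rewrite E0, Cmult_0_r in Em.
  rewrite <- Em in Hpos; simpl in Hpos; lra.
Qed.

Lemma landau_boundary (z : C) : Cmod z = r / L ->
  landau_radius r L 1
  <= Cmod ((h z + Cconj (g z)) - (h 0 + Cconj (g 0))).
Proof.
  intros Hz.
  destruct (exists_rotation (h z - h 0) (g z - g 0)) as (c & Hc & Hle).
  replace (h z + Cconj (g z) - (h 0 + Cconj (g 0)))%C
    with (h z - h 0 + Cconj (g z - g 0))%C by (rewrite Cminus_conj; ring).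
  eapply Rle_trans; [|exact Hle].
  assert (HrL : 0 < r / L) by (apply Rdiv_lt_0_compat; lra).
  assert (HrL' : r / L < r) by (apply Rlt_div_l; nra).
  assert (Hz0 : z <> 0) by (apply Cmod_gt_0; lra).
  pose proof (rotated_centre c Hc) as Hcen.
  set (a := (h1 0 + c * g1 0)%C) in *.
  assert (Ha : a <> 0) by (apply Cmod_gt_0; lra).
  set (Phi := fun w => (h w + c * g w)%C).
  (* A unimodular number with u z = (r / L) conj a / |a|, so that the radial derivative of Re (u
     Phi) is r / L times the real part bounded from below. *)
  set (u := (RtoC (r / L / Cmod a) * (Cconj a * / z))%C).
  assert (Hu : Cmod u = 1).
  { unfold u; rewrite !Cmod_mult, Cmod_conj, Cmod_inv, Cmod_R, Hz, Rabs_pos_eq;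
      auto.
    - field; lra.
    - apply Rdiv_le_0_compat; lra. }
  (* The difference of Re (u Phi) and [landau_radius] has nonnegative derivative, so one application
     of the mean value theorem replaces integration. *)
  destruct (MVT_cor2
    (fun s => Rminus (Re (u * Phi (0 + RtoC s * z))%C) (landau_radius r L s))
    (fun s => Rminus (Re (u * (h1 (0 + RtoC s * z) + c * g1 (0 + RtoC s * z)) * z)%C)
       (r / L * (L * (1 - L * (s / L)) / (L - s / L)))) 0 1)
    as (s & E & Hs); [lra| |].
  { intros s Hs; apply is_derive_Reals.
    apply (is_derive_minus (fun s => Re (u * Phi (0 + RtoC s * z))%C)
      (landau_radius r L)); [|now apply is_derive_landau_radius].
    apply (is_derive_slice Phi 0 z u), rotated_derivative.
    rewrite Cplus_0_l, Cmod_mult, Cmod_R, Rabs_pos_eq, Hz by lra; nra. }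
  assert (Hsz : Cmod (0 + RtoC s * z) = s * (r / L))
    by (rewrite Cplus_0_l, Cmod_mult, Cmod_R, Rabs_pos_eq, Hz; lra).
  pose proof (rotated_real_part c (0 + RtoC s * z)%C Hc) as H.
  rewrite Hsz in H; specialize (H ltac:(nra)); fold a in H.
  replace (s * (r / L) / r) with (s / L) in H by (field; lra).
  replace (u * (h1 (0 + RtoC s * z) + c * g1 (0 + RtoC s * z)) * z)%C
    with (RtoC (r / L / Cmod a)
          * (Cconj a * (h1 (0 + RtoC s * z) + c * g1 (0 + RtoC s * z))))%C in E
    by (unfold u; field; auto).
  rewrite re_scal_l in E.
  replace (0 + RtoC 1 * z)%C with z in E by ring.
  replace (0 + RtoC 0 * z)%C with (RtoC 0) in E by ring.
  set (X := Re (Cconj a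
    * (h1 (0 + RtoC s * z) + c * g1 (0 + RtoC s * z)))%C) in *.
  assert (HX : r / L * (L * (1 - L * (s / L)) / (L - s / L))
               <= r / L / Cmod a * X).
  { replace (r / L / Cmod a * X) with (r / L * (X / Cmod a)) by (field; lra).
    apply Rmult_le_compat_l; lra. }
  assert (E0 : landau_radius r L 0 = 0).
  { unfold landau_radius, Rdiv; rewrite Rmult_0_l, Rminus_0_r; ring. }
  rewrite E0 in E.
  assert (Hre : Re (u * (h z - h 0 + c * (g z - g 0)))%C
                = Re (u * Phi z)%C - Re (u * Phi 0)%C)
    by (unfold Phi, Re; simpl; ring).
  pose proof (re_le_Cmod (u * (h z - h 0 + c * (g z - g 0)))) as Hm.
  rewrite Cmod_mult, Hu, Rmult_1_l in Hm.
  pose proof (Rle_abs (Re (u * (h z - h 0 + c * (g z - g 0)))%C)) as Hm'.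
  lra.
Qed.

End Landau.

(** The number m = (1 + M) / 2 exceeds M strictly because M < 1. The half plane Re < m is used for h
    if Re h(z) >= 0 and for -h otherwise, so the distance from the value at z to the edge is at most
    m, and 2 m = 1 + M. *)
Lemma real_part_derivative_bound (h h1 h2 : C -> C) (M : R) (z : C) :
  (forall w, Cmod w < 1 -> cderiv h w (h1 w) /\ cderiv h1 w (h2 w)) ->
  (forall w, Cmod w < 1 -> Rabs (Re (h w)) <= M) -> M < 1 -> Cmod z < 1 ->
  (1 - Cmod z) * Cmod (h1 z) <= 1 + M.
Proof.
  intros Hh HM HM1 Hz.
  assert (Hin : forall w, Cmod (w - z) < 1 - Cmod z -> Cmod w < 1).
  { intros w Hw; pose proof (Cmod_le_diff w z); lra. }
  assert (Hol : hol2 (fun w => Cmod (w - z) < 1 - Cmod z) h).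
  { exists h1, h2; auto. }
  destruct (Rle_lt_dec 0 (Re (h z))) as [Hs|Hs].
  - pose proof (half_plane_derivative_bound h z (h1 z) (1 - Cmod z)
      ((1 + M) / 2)) as H.
    assert (Hg : (1 - Cmod z) * Cmod (h1 z) <= 2 * ((1 + M) / 2 - Re (h z))).
    { apply H; auto; [lra|now apply Hh|].
      intros w Hw; specialize (HM w (Hin w Hw)).
      pose proof (Rle_abs (Re (h w))); lra. }
    lra.
  - pose proof (half_plane_derivative_bound (fun w => 0 - h w)%C z (0 - h1 z)
      (1 - Cmod z) ((1 + M) / 2)) as H.
    assert (Hg : (1 - Cmod z) * Cmod (0 - h1 z)
                 <= 2 * ((1 + M) / 2 - Re (0 - h z)%C)).
    { apply H; [lra| | |].
      - apply hol2_minus; auto; apply hol2_const.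
      - apply cderiv_minus; [apply cderiv_const|now apply Hh].
      - intros w Hw; specialize (HM w (Hin w Hw)).
        pose proof (Rle_abs (- Re (h w))) as Ha; rewrite Rabs_Ropp in Ha.
        unfold Re in *; simpl; lra. }
    replace (0 - h1 z)%C with (- h1 z)%C in Hg by ring.
    rewrite Cmod_opp in Hg; unfold Re in *; simpl in Hg; lra.
Qed.

(** * The explicit radii and the assembly of the proof *)

Lemma r8_eq (K M : R) : 1 <= K -> 0 <= M ->
  r8 K M = / sqrt 3 / (6 * K * (1 + M) / (K + 1)).
Proof.
  intros HK HM; unfold r8.
  assert (0 < sqrt 3) by (apply sqrt_lt_R0; lra).
  field; repeat split; lra.
Qed.

(** Writing L - 1/L = L (1 - 1/L^2) cancels ln L and leaves the single logarithm of the closed form;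
    the prefactor is L / sqrt 3. *)
Lemma r9_eq (K M : R) : 1 <= K -> 0 <= M ->
  r9 K M = landau_radius (/ sqrt 3) (6 * K * (1 + M) / (K + 1)) 1.
Proof.
  intros HK HM; unfold r9, landau_radius.
  assert (H3 : 0 < sqrt 3) by (apply sqrt_lt_R0; lra).
  assert (Hss : sqrt 3 * sqrt 3 = 3) by (apply sqrt_sqrt; lra).
  set (L := 6 * K * (1 + M) / (K + 1)).
  assert (HL : 3 <= L).
  { unfold L; apply (proj1 (Rle_div_r 3 (6 * K * (1 + M)) (K + 1) ltac:(lra))).
    nra. }
  replace (2 * sqrt 3 * K * (1 + M) / (K + 1)) with (/ sqrt 3 * L).
  2:{ unfold L; replace (/ sqrt 3) with (sqrt 3 / 3).
      - field; lra.
      - apply Rmult_eq_reg_l with (sqrt 3); [|lra]; unfold Rdiv.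
        rewrite Rinv_r, <- Rmult_assoc, Hss by lra; field. }
  replace (36 * K ^ 2 * (1 + M) ^ 2 / (K + 1) ^ 2) with (L ^ 2)
    by (unfold L; field; lra).
  replace ((K + 1) ^ 2 / (36 * K ^ 2 * (1 + M) ^ 2)) with (/ L ^ 2)
    by (unfold L; field; lra).
  replace (L - 1 / L) with (L * (1 - / L ^ 2)) by (field; lra).
  assert (/ L ^ 2 < 1).
  { rewrite <- Rinv_1; apply Rinv_lt_contravar; nra. }
  rewrite ln_mult by lra; ring.
Qed.

Theorem theorem3p5 (K M : R) (f h g : C -> C)
  (hK : 1 <= K)
  (hM0 : 0 <= M) (hM1 : M < 1)
  (hh : analytic_on unit_disk h)
  (hg : analytic_on unit_disk g)
  (hf : forall z : C, unit_disk z -> f z = (h z + Cconj (g z))%C)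
  (hqr : quasiregular_harmonic_on unit_disk K f)
  (hf0 : f (RtoC 0) = RtoC 0)
  (hlam : lambda f (RtoC 0) = 1)
  (hRe : forall z : C, unit_disk z -> Rabs (Re (h z)) <= M) :
  univalent_on (disk (RtoC 0) (r8 K M)) f /\
  contains_schlicht_disk (disk (RtoC 0) (r8 K M)) f (RtoC 0) (r9 K M).
Proof.
  destruct hqr as (Hharm & Hsense & Hquasi).
  assert (HD : Copen unit_disk) by apply disk_Copen.
  destruct (harmonic_parts unit_disk f h g HD hh hg hf Hharm)
    as (h1 & h2 & g1 & g2 & Hd).
  assert (Hm0 : forall z : C, (z - 0 = z)%C) by (intros; ring).
  assert (Hunit : forall z, Cmod z < 1 -> unit_disk z)
    by (intros z Hz; unfold unit_disk, disk; now rewrite Hm0).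
  assert (HJ : forall z, unit_disk z -> Cmod (g1 z) < Cmod (h1 z)).
  { intros z Hz; specialize (Hsense z Hz); unfold Jacobian in Hsense.
    destruct (Hd z Hz) as (_ & _ & _ & _ & E1 & E2).
    rewrite E1, E2, Cmod_conj in Hsense.
    pose proof (Cmod_ge_0 (h1 z)); pose proof (Cmod_ge_0 (g1 z)); nra. }
  assert (H0 : unit_disk 0) by (apply Hunit; rewrite Cmod_0; lra).
  assert (Hcen : Cmod (h1 0) - Cmod (g1 0) = 1).
  { unfold lambda in hlam; destruct (Hd 0 H0) as (_ & _ & _ & _ & E1 & E2).
    rewrite E1, E2, Cmod_conj, Rabs_pos_eq in hlam; auto.
    specialize (HJ 0 H0); lra. }
  set (rho := / sqrt 3); set (L := 6 * K * (1 + M) / (K + 1)).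
  assert (H3 : 0 < sqrt 3) by (apply sqrt_lt_R0; lra).
  assert (Hrho0 : 0 < rho) by now apply Rinv_0_lt_compat.
  assert (Hrho : rho < 2 / 3).
  { assert (3 / 2 < sqrt 3).
    { apply Rsqr_incrst_0; [|lra|lra].
      rewrite Rsqr_sqrt by lra; unfold Rsqr; lra. }
    unfold rho; replace (2 / 3) with (/ (3 / 2)) by field.
    apply Rinv_lt_contravar; nra. }
  assert (HL : 3 <= L).
  { unfold L; apply (proj1 (Rle_div_r 3 (6 * K * (1 + M)) (K + 1) ltac:(lra))).
    nra. }
  assert (Hbound : forall z, Cmod z < rho -> Cmod (h1 z) + Cmod (g1 z) < L).
  { intros z Hz.
    assert (Hz1 : unit_disk z) by (apply Hunit; lra).
    assert (Hb : (1 - Cmod z) * Cmod (h1 z) <= 1 + M).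
    { apply (real_part_derivative_bound h h1 h2 M z); auto; [|lra].
      intros w Hw; destruct (Hd w (Hunit w Hw)) as (A1 & A2 & _); auto. }
    specialize (Hquasi z Hz1); unfold Lambda, lambda in Hquasi.
    destruct (Hd z Hz1) as (_ & _ & _ & _ & E1 & E2).
    specialize (HJ z Hz1).
    rewrite E1, E2, Cmod_conj, Rabs_pos_eq in Hquasi by lra.
    pose proof (Cmod_ge_0 (g1 z)).
    (* As |z| < 2/3, the factor 1 - |z| exceeds 1/3. *)
    assert (Hh1 : Cmod (h1 z) < 3 * (1 + M)) by nra.
    unfold L.
    (* Quasiregularity reads (K + 1) |g'| <= (K - 1) |h'|, hence (K + 1)(|h'| + |g'|) <= 2 K
       |h'|. *)
    apply (proj1 (Rlt_div_r (Cmod (h1 z) + Cmod (g1 z)) (6 * K * (1 + M))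
      (K + 1) ltac:(lra))).
    nra. }
  assert (Hdh : forall z, Cmod z < rho ->
    cderiv h z (h1 z) /\ cderiv h1 z (h2 z)).
  { intros z Hz; destruct (Hd z) as (A1 & A2 & _); [apply Hunit; lra|auto]. }
  assert (Hdg : forall z, Cmod z < rho ->
    cderiv g z (g1 z) /\ cderiv g1 z (g2 z)).
  { intros z Hz; destruct (Hd z) as (_ & _ & A1 & A2 & _);
      [apply Hunit; lra|auto]. }
  rewrite r8_eq, r9_eq by auto; fold rho L.
  assert (HrL : 0 < rho / L) by (apply Rdiv_lt_0_compat; lra).
  assert (HrL1 : rho / L < 1) by (apply Rlt_div_l; lra).
  assert (Hinj : univalent_on (disk 0 (rho / L)) f).
  { intros z w Hz Hw E; unfold disk in Hz, Hw; rewrite Hm0 in Hz, Hw.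
    rewrite !hf in E by (apply Hunit; lra).
    apply (landau_univalent h h1 h2 g g1 g2 rho L); auto; lra. }
  split; [exact Hinj|].
  (* Only the centre of the target disc becomes f(0); the centre of the source disc stays 0. *)
  rewrite <- hf0 at 2.
  apply (schlicht_disk_of_boundary unit_disk); auto.
  - apply landau_radius_pos; lra.
  - intros z; rewrite Hm0; intros Hz; apply Hunit; lra.
  - intros z Hz; exists (h1 z), (g1 z); split; auto.
    destruct (Hd z Hz) as (A1 & _ & A2 & _).
    now apply (hdiff_sum unit_disk f h g).
  - intros z; rewrite Hm0; intros Hz.
    rewrite !hf by (auto; apply Hunit; lra).
    apply (landau_boundary h h1 h2 g g1 g2); auto; lra.
Qed.
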